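(* Let $R$ be a ring, let $A=R[x]/(x^2)$, and let $M$ be a graded left $A$-module. The following are equivalent: (1) $M$ is Gorenstein projective in $\mathrm{GrMod}(A)$; (2) the ungraded $A$-module $M$ is Gorenstein projective in $\mathrm{Mod}(A)$; (3) the underlying $R$-module $M$ is Gorenstein projective in $\mathrm{Mod}(R)$.
   Context: Rings are associative with unit; $R$ is arbitrary. In $A=R[x]/(x^2)$ the variable $x$ commutes with all elements of $R$. $A$ is viewed as a graded ring with a copy of $R$ (generated by $1$) in degree $0$, a copy of $R$ (generated by $x$) in degree $1$, and $0$ in all other degrees. A graded $A$-module is a left $A$-module $M$ with a decomposition $M=\bigoplus_{i\in\mathbb{Z}}M^i$ into additive subgroups with $A^iM^j\subset M^{i+j}$ for all $i,j$. $\mathrm{GrMod}(A)$ is the category of graded left $A$-modules with $A$-linear maps $f$ of degree zero ($f(M^i)\subset N^i$) as morphisms. $\mathrm{Mod}(S)$ is the category of left $S$-modules; the ungraded module of $M$ is obtained by forgetting the grading and the underlying $R$-module by restricting scalars along $R\subset A$. In an abelian category $\mathcal{C}$ with enough projectives, an object $M$ is Gorenstein projective if there is an acyclic complex $\mathbf{P}=\cdots\to P_1\to P_0\to P_{-1}\to\cdots$ of projective objects such that $\mathrm{Hom}_{\mathcal{C}}(\mathbf{P},P)$ is acyclic for every projective object $P$ of $\mathcal{C}$, with $M=\mathrm{Ker}(P_0\to P_{-1})$. *)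

(* Defs.v *)
(* Morphisms are compared by Leibniz equality; the category laws below therefore
   rest on the extensionality axioms of mathcomp.classical.boolp. *)
From HB Require Import structures.
From mathcomp Require Import all_boot all_order all_algebra.
From mathcomp Require Import boolp.

Set Implicit Arguments.
Unset Strict Implicit.
Unset Printing Implicit Defensive.

Import GRing.Theory.
Local Open Scope ring_scope.

(* Composition and zero morphisms are all that the notions below need from an
   abelian category. *)
Record category := Category {
  object :> Type;
  cat_hom : object -> object -> Type;
  cat_id : forall a, cat_hom a a;
  cat_comp : forall a b c, cat_hom b c -> cat_hom a b -> cat_hom a c;
  cat_zero : forall a b, cat_hom a b;
  cat_comp1m : forall a b (f : cat_hom a b), cat_comp (cat_id b) f = f;
  cat_compm1 : forall a b (f : cat_hom a b), cat_comp f (cat_id a) = f;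
  cat_compA : forall a b c d (f : cat_hom c d) (g : cat_hom b c) (h : cat_hom a b),
    cat_comp f (cat_comp g h) = cat_comp (cat_comp f g) h;
  cat_comp0m : forall a b c (f : cat_hom a b), cat_comp (cat_zero b c) f = cat_zero a c;
  cat_compm0 : forall a b c (f : cat_hom b c), cat_comp f (cat_zero a b) = cat_zero a c
}.

Arguments cat_hom {c} : rename.
Arguments cat_id {c} a : rename.
Arguments cat_comp {c a b c0} : rename.
Arguments cat_zero {c} a b : rename.

Section GorensteinProjective.
Variable C : category.
Implicit Types a b c : C.

Definition is_epi a b (e : cat_hom a b) : Prop :=
  forall c (u v : cat_hom b c), cat_comp u e = cat_comp v e -> u = v.

Definition is_kernel a b k (g : cat_hom a b) (i : cat_hom k a) : Prop :=
  cat_comp g i = cat_zero k b /\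
  forall c (h : cat_hom c a), cat_comp g h = cat_zero c b ->
    exists! u : cat_hom c k, cat_comp i u = h.

(* Exactness of a --f--> b --g--> c: the corestriction of f to Ker g is epi. *)
Definition exact_at a b c (f : cat_hom a b) (g : cat_hom b c) : Prop :=
  exists k (i : cat_hom k b) (e : cat_hom a k),
    [/\ is_kernel g i, is_epi e & f = cat_comp i e].

Definition is_projective p : Prop :=
  forall a b (e : cat_hom a b) (f : cat_hom p b), is_epi e ->
    exists g : cat_hom p a, cat_comp e g = f.

(* Homological indexing. Stating i = j + 1 as a premise, instead of typing the
   differential as cc_term (j + 1) -> cc_term j, avoids casts along identities of
   int. *)
Record chain_complex := ChainComplex {
  cc_term :> int -> C;
  cc_diff : forall i j : int, i = j + 1 -> cat_hom (cc_term i) (cc_term j);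
  cc_diff_comp : forall (i j k : int) (ij : i = j + 1) (jk : j = k + 1),
    cat_comp (cc_diff jk) (cc_diff ij) = cat_zero (cc_term i) (cc_term k)
}.

Definition acyclic (P : chain_complex) : Prop :=
  forall (i j k : int) (ij : i = j + 1) (jk : j = k + 1),
    exact_at (cc_diff P ij) (cc_diff P jk).

(* Acyclicity of the complex of abelian groups Hom(P, q): every cocycle
   P_j -> q is a coboundary (the converse is cc_diff_comp). *)
Definition hom_acyclic (P : chain_complex) (q : C) : Prop :=
  forall (i j k : int) (ij : i = j + 1) (jk : j = k + 1) (f : cat_hom (P j) q),
    cat_comp f (cc_diff P ij) = cat_zero (P i) q ->
    exists g : cat_hom (P k) q, cat_comp g (cc_diff P jk) = f.

(* The proof erefl of 0 = -1 + 1 selects the differential P_0 -> P_{-1}. *)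
Definition Gorenstein_projective (m : C) : Prop :=
  exists P : chain_complex,
    [/\ acyclic P,
        forall n, is_projective (P n),
        forall q : C, is_projective q -> hom_acyclic P q
      & exists i : cat_hom m (P 0), is_kernel (cc_diff P (erefl : 0 = -1 + 1 :> int)) i].

End GorensteinProjective.

Section ModuleCategory.
Variable S : pzRingType.
Implicit Types U V W : lmodType S.

Lemma linear_ext U V (f g : {linear U -> V}) : f =1 g -> f = g.
Proof.
case: f g => f [[f1] [f2]] [g [[g1] [g2]]] /= /funext fg.
by move: fg f1 f2 g1 g2 => -> f1 f2 g1 g2; do 4!f_equal; apply: Prop_irrelevance.
Qed.

Definition linear_id U : {linear U -> U} := idfun.
Definition linear_comp U V W (f : {linear V -> W}) (g : {linear U -> V}) :
  {linear U -> W} := f \o g.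
Definition linear_zero U V : {linear U -> V} := \0.

Lemma linear_comp0 U V W (f : {linear V -> W}) :
  linear_comp f (linear_zero U V) = linear_zero U W.
Proof. by apply: linear_ext => x /=; rewrite raddf0. Qed.

Definition Mod : category.
Proof.
refine (@Category (lmodType S) (fun U V => {linear U -> V})
  linear_id linear_comp linear_zero _ _ _ _ linear_comp0);
  by move=> *; apply: linear_ext.
Defined.

End ModuleCategory.

(* R[x]/(x^2), the pair (a, b) standing for a + b x.  ({poly R} is not available
   for the zero ring; see dual_polyP for the comparison.) *)
Definition dual_num (R : pzRingType) : Type := (R * R)%type.

Section DualRing.
Variable R : pzRingType.

HB.instance Definition _ := GRing.Zmodule.on (dual_num R).

Definition dual_one : dual_num R := (1, 0).
Definition dual_mul (p q : dual_num R) : dual_num R :=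
  (p.1 * q.1, p.1 * q.2 + p.2 * q.1).

Fact dual_mulA : associative dual_mul.
Proof.
by move=> p q r; rewrite /dual_mul /= mulrDr mulrDl !mulrA addrA.
Qed.
Fact dual_mul1r : left_id dual_one dual_mul.
Proof. by case=> a b; rewrite /dual_mul /= !mul1r mul0r addr0. Qed.
Fact dual_mulr1 : right_id dual_one dual_mul.
Proof. by case=> a b; rewrite /dual_mul /= !mulr1 mulr0 add0r. Qed.
Fact dual_mulDl : left_distributive dual_mul +%R.
Proof.
by move=> p q r; congr (_, _); rewrite /= !mulrDl // addrACA.
Qed.
Fact dual_mulDr : right_distributive dual_mul +%R.
Proof.
by move=> p q r; congr (_, _); rewrite /= !mulrDr // addrACA.
Qed.

HB.instance Definition _ := GRing.Zmodule_isPzRing.Build (dual_num R)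
  dual_mulA dual_mul1r dual_mulr1 dual_mulDl dual_mulDr.

Definition dual_const (a : R) : dual_num R := (a, 0).
Definition dual_x : dual_num R := (0, 1).

Fact dual_const_is_additive : additive dual_const.
Proof. by move=> a b; congr (_, _); rewrite /= subr0. Qed.
HB.instance Definition _ :=
  GRing.isAdditive.Build R (dual_num R) dual_const dual_const_is_additive.
Fact dual_const_is_monoid_morphism : monoid_morphism dual_const.
Proof.
by split=> // a b; congr (_, _); rewrite /= mulr0 mul0r addr0.
Qed.
HB.instance Definition _ := GRing.isMonoidMorphism.Build R (dual_num R) dual_const
  dual_const_is_monoid_morphism.

Definition dual_deg (i : int) (p : dual_num R) : Prop :=
  if i == 0 then p.2 = 0 else if i == 1 then p.1 = 0 else p = 0.

End DualRing.

Definition dual_of_poly (R : nzRingType) (p : {poly R}) : dual_num R := (p`_0, p`_1).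

Lemma dual_polyP (R : nzRingType) :
  [/\ additive (@dual_of_poly R), monoid_morphism (@dual_of_poly R),
      (forall a : R, dual_of_poly a%:P = dual_const a) /\
        @dual_of_poly R 'X = dual_x R,
      forall y : dual_num R, exists p : {poly R}, dual_of_poly p = y
    & forall p : {poly R}, dual_of_poly p = 0 <-> exists q : {poly R}, p = q * 'X^2].
Proof.
split=> [p q|||[a b]|p].
- by congr (_, _); rewrite /= coefB.
- split=> [|p q]; first by rewrite /dual_of_poly !coef1.
  congr (_, _); rewrite coefM !big_ord_recr big_ord0 /= ?add0r //.
- by split=> [a|]; rewrite /dual_of_poly ?coefC ?coefX.
- exists (a%:P + b%:P * 'X).
  by rewrite /dual_of_poly !coefD !coefC !coefMX !coefC /= addr0 add0r.
- split=> [[p0 p1]|[q ->]]; last by rewrite /dual_of_poly !coefMXn.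
  exists (drop_poly 2 p); rewrite -[LHS](poly_take_drop 2).
  suff -> : take_poly 2 p = 0 by rewrite add0r.
  by apply/polyP=> -[|[|i]]; rewrite coef_take_poly coef0.
Qed.

Definition restriction (R S : pzRingType) (phi : {rmorphism R -> S})
  (M : lmodType S) : Type := M.

Section Restriction.
Variables (R S : pzRingType) (phi : {rmorphism R -> S}) (M : lmodType S).

HB.instance Definition _ := GRing.Zmodule.on (restriction phi M).

Definition restriction_scale (a : R) (m : restriction phi M) :
  restriction phi M := phi a *: (m : M).

Fact restriction_scaleA a b m :
  restriction_scale a (restriction_scale b m) = restriction_scale (a * b) m.
Proof. by rewrite /restriction_scale scalerA rmorphM. Qed.
Fact restriction_scale1 : left_id 1 restriction_scale.
Proof. by move=> m; rewrite /restriction_scale rmorph1 scale1r. Qed.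
Fact restriction_scaleDr : right_distributive restriction_scale +%R.
Proof. by move=> a m n; exact: scalerDr. Qed.
Fact restriction_scaleDl m : {morph restriction_scale^~ m : a b / a + b}.
Proof. by move=> a b; rewrite /restriction_scale rmorphD scalerDl. Qed.

HB.instance Definition _ := GRing.Zmodule_isLmodule.Build R (restriction phi M)
  restriction_scaleA restriction_scale1 restriction_scaleDr restriction_scaleDl.

End Restriction.

(* The degree decomposition is an internal direct sum: gmod_span gives the sum,
   gmod_free its directness. *)
Record gmod (R : pzRingType) := GradedModule {
  gmod_sort :> lmodType (dual_num R);
  gmod_deg : int -> gmod_sort -> Prop;
  gmod_deg0 : forall i, gmod_deg i 0;
  gmod_degB : forall i m n, gmod_deg i m -> gmod_deg i n -> gmod_deg i (m - n);
  gmod_span : forall m, exists (s : seq int) (f : int -> gmod_sort),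
    [/\ uniq s, forall i, gmod_deg i (f i) & m = \sum_(i <- s) f i];
  gmod_free : forall (s : seq int) (f : int -> gmod_sort),
    uniq s -> (forall i, gmod_deg i (f i)) -> \sum_(i <- s) f i = 0 ->
    forall i, i \in s -> f i = 0;
  gmod_degZ : forall i j (p : dual_num R) m,
    dual_deg i p -> gmod_deg j m -> gmod_deg (i + j) (p *: m)
}.

Arguments gmod_deg {R} M i m : rename.

Record ghom (R : pzRingType) (M N : gmod R) := GradedHom {
  ghom_fun :> {linear M -> N};
  ghom_deg : forall i m, gmod_deg M i m -> gmod_deg N i (ghom_fun m)
}.

Section GradedModuleCategory.
Variable R : pzRingType.
Implicit Types M N L : gmod R.

Lemma ghom_ext M N (f g : ghom M N) : f =1 g -> f = g.
Proof.
case: f g => f fdeg [g gdeg] /= /linear_ext fg.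
by move: fg fdeg gdeg => -> fdeg gdeg; congr GradedHom; apply: Prop_irrelevance.
Qed.

Definition ghom_id M : ghom M M := @GradedHom R M M (linear_id M) (fun _ _ => id).
Definition ghom_comp M N L (f : ghom N L) (g : ghom M N) : ghom M L :=
  @GradedHom R M L (linear_comp f g)
    (fun i m mi => ghom_deg f (ghom_deg g mi)).
Definition ghom_zero M N : ghom M N :=
  @GradedHom R M N (linear_zero M N) (fun i _ _ => gmod_deg0 N i).

Lemma ghom_comp0 M N L (f : ghom N L) :
  ghom_comp f (ghom_zero M N) = ghom_zero M L.
Proof. by apply: ghom_ext => x /=; rewrite raddf0. Qed.

Definition GrMod : category.
Proof.
refine (@Category (gmod R) (@ghom R) ghom_id ghom_comp ghom_zero
  _ _ _ _ ghom_comp0);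
  by move=> *; apply: ghom_ext.
Defined.

End GradedModuleCategory.

(* Main.v *)
Require Import Defs.
From HB Require Import structures.
From mathcomp Require Import all_boot all_order all_algebra.
From mathcomp Require Import ring_quotient.
From mathcomp Require Import boolp classical_sets functions fsbigop.

(** Let A = R[x]/(x^2), let U be the functor from graded A-modules to A-modules
    that forgets the grading, and let rho be the restriction of scalars from A
    to R.  The proof rests on the adjoints of these two functors.

    - U has the right adjoint F, F Q = Q[t, 1/t] graded by powers of t, where x
      acts as x t; and F has the right adjoint Pi, which sends N to the product
      of its homogeneous components N^i ([forget_laurent], [laurent_product]).
    - rho has the left adjoint Ind, Ind V = V + x V; this functor is also its
      right adjoint, as the coefficient of x is a Frobenius form on A
      ([extend_restrict], [restrict_extend]).

    Going down.  Suppose L -| F -| G, where L preserves kernels and G preserves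
    epimorphisms.  Then L and F preserve projectives, L preserves exactness, and
    Hom(L P, Q) = Hom(P, F Q), so L carries complete projective resolutions to
    complete projective resolutions ([Gorenstein_projective_adjoint]).  Applied
    to U -| F -| Pi and to rho -| Ind -| rho, this gives the implications
    from graded A-modules to A-modules, and from A-modules to R-modules.

    Going up.  Put L = rho U, Phi = F Ind and Pi' = rho Pi, so L -| Phi -| Pi'.
    Let P be a complete projective resolution of the R-module L M, with cycles
    Z_n.  Consider the class of the graded modules a such that L a is a stable
    retract of some Z_n, that is, id = b a' + d c where b a' factors through Z_n
    and d c through a projective module.  This class can be resolved on both
    sides, with all the kernels and cokernels inside the class.

    - On the right: the inclusion Z_n -> P_n and the map c combine to an
      embedding j of L a into a projective R-module P', and every map from L a
      to a projective module extends along j ([stable_retract_embedding]).  The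
      transpose a -> Phi P' of j is again injective, and inherits the extension
      property because j factors through its image under L ([embedding_adj]).
    - On the left: Pi' is faithful, so the transpose of an epimorphism from a
      projective R-module V to Pi' a is an epimorphism Phi V -> a
      ([enough_free]).

    Comparing these sequences with Z_n -> P_n -> Z_(n-1) and with
    Z_(n+1) -> P_(n+1) -> Z_n shows that the new modules are stable retracts of
    Z_(n-1) and of Z_(n+1) ([stable_retract_cosyzygy],
    [stable_retract_syzygy]).  Each projective graded module is a retract of some
    Phi V, hence the extension properties over R give those over A
    ([extends_underlying]), and splicing the short exact sequences yields a
    complete resolution of M ([Gorenstein_projective_of_class]). *)

Set Implicit Arguments.
Unset Strict Implicit.
Unset Printing Implicit Defensive.

Import GRing.Theory.
Local Open Scope ring_scope.

Local Notation "g '\c' f" := (cat_comp g f) (at level 40, left associativity).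

(** * Splicing short exact sequences *)

Section Splicing.
Variable C : category.
Implicit Types a b c q : C.

Lemma kernel_mono a b c d (g : cat_hom b c) (i : cat_hom a b) (u v : cat_hom d a) :
  is_kernel g i -> i \c u = i \c v -> u = v.
Proof.
move=> [gi0 univ] iuv.
have [|w [_ wuniq]] := univ _ (i \c v); first by rewrite cat_compA gi0 cat_comp0m.
by rewrite -(wuniq u iuv) -(wuniq v erefl).
Qed.

Lemma kernel_mono_comp a b c d (g : cat_hom b c) (i : cat_hom a b)
    (k : cat_hom c d) :
  (forall e (u v : cat_hom e c), k \c u = k \c v -> u = v) ->
  is_kernel g i -> is_kernel (k \c g) i.
Proof.
move=> kmono [gi0 univ]; split; first by rewrite -cat_compA gi0 cat_compm0.
move=> e h; rewrite -cat_compA => kgh0; apply: univ.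
by apply: kmono; rewrite kgh0 cat_compm0.
Qed.

(** In an abelian category the last clause follows from the other two, an
    epimorphism being the cokernel of its kernel; [category] has no such axiom. *)
Definition short_exact a b c (i : cat_hom a b) (p : cat_hom b c) : Prop :=
  [/\ is_kernel p i, is_epi p
    & forall d (h : cat_hom b d), h \c i = cat_zero a d ->
        exists u : cat_hom c d, u \c p = h].

(** For the first map of a short exact sequence with projective middle term
    b and cokernel c, this says that Ext^1(c, q) vanishes. *)
Definition extends_along a b (i : cat_hom a b) q : Prop :=
  forall f : cat_hom a q, exists g : cat_hom b q, g \c i = f.

Variable X : C -> Prop.

(** One step of a two-sided projective resolution that stays in the class X. *)
Record link := Link {
  link_sub : C;
  link_mid : C;
  link_quo : C;
  link_in : cat_hom link_sub link_mid;
  link_out : cat_hom link_mid link_quo;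
  link_exact : short_exact link_in link_out;
  link_proj : is_projective link_mid;
  link_ext : forall q, is_projective q -> extends_along link_in q;
  link_subX : X link_sub;
  link_quoX : X link_quo
}.

Section Chain.
Variables (w : int -> link)
  (wP : forall i j : int, i = j + 1 -> link_quo (w i) = link_sub (w j)).

(** The end of one link is only propositionally equal to the start of the next,
    so the map is transported along that equality; [chain_exact] then holds for
    the transported map, and hides the transport from all later arguments. *)
Definition chain_out i j (ij : i = j + 1) :
    cat_hom (link_mid (w i)) (link_sub (w j)) :=
  ecast z (cat_hom (link_mid (w i)) z) (wP ij) (link_out (w i)).

Lemma chain_exact i j (ij : i = j + 1) :
  short_exact (link_in (w i)) (chain_out ij).
Proof.
by rewrite /chain_out; case: _ / (wP ij); apply: link_exact.
Qed.

Definition chain_diff i j (ij : i = j + 1) :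
    cat_hom (link_mid (w i)) (link_mid (w j)) :=
  link_in (w j) \c chain_out ij.

Lemma chain_diff_comp i j k (ij : i = j + 1) (jk : j = k + 1) :
  chain_diff jk \c chain_diff ij = cat_zero (link_mid (w i)) (link_mid (w k)).
Proof.
have [[oi0 _] _ _] := chain_exact jk.
rewrite /chain_diff cat_compA -[X in X \c _]cat_compA oi0.
by rewrite cat_compm0 cat_comp0m.
Qed.

Definition chain := ChainComplex chain_diff_comp.

Lemma chain_kernel j k (jk : j = k + 1) :
  is_kernel (cc_diff chain jk) (link_in (w j)).
Proof.
have [outK _ _] := chain_exact jk.
apply: kernel_mono_comp outK => e u v.
by have [inK _ _] := link_exact (w k); apply: kernel_mono inK.
Qed.

(** A cocycle on the j-th term vanishes on the subobject [link_sub (w j)], so it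
    descends to the cokernel, which is [link_sub (w k)]; from there it extends to
    the next term by [link_ext]. *)
Lemma chain_Gorenstein : Gorenstein_projective (link_sub (w 0)).
Proof.
exists chain; split=> [i j k ij jk|n|q qproj i j k ij jk f /= fd0|].
- exists (link_sub (w j)), (link_in (w j)), (chain_out ij).
  by split=> //; [exact: chain_kernel | have [] := chain_exact ij].
- exact: link_proj.
- have [_ outE _] := chain_exact ij.
  have [_ _ outF] := chain_exact jk.
  have /outF[g gf]: f \c link_in (w j) = cat_zero _ q.
    by apply: outE; rewrite -cat_compA fd0 cat_comp0m.
  have [h hg] := @link_ext (w k) _ qproj g.
  by exists h; rewrite /= /chain_diff cat_compA hg.
- by exists (link_in (w 0)); apply: chain_kernel.
Qed.
End Chain.

(** Both hypotheses can be iterated, because each new object lies in X again;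
    starting at a, this gives a doubly infinite chain of links. *)
Theorem Gorenstein_projective_of_class
    (cosyzygy : forall a, X a -> exists l : link, link_sub l = a)
    (syzygy : forall a, X a -> exists l : link, link_quo l = a) a :
  X a -> Gorenstein_projective a.
Proof.
move=> /cosyzygy[w0 <-].
have [R RP] := choice (fun l : link => cosyzygy _ (link_quoX l)).
have [L LP] := choice (fun l : link => syzygy _ (link_subX l)).
(* With this numbering link i ends where link (i - 1) starts, and a = link_sub
   (w 0) is the kernel of the differential leaving degree 0. *)
pose w (i : int) := match i with Posz n => iter n L w0 | Negz n => iter n.+1 R w0 end.
have wP (i j : int) : i = j + 1 -> link_quo (w i) = link_sub (w j).
  case: j => [n|[|n]] ->; rewrite /=.
  - by rewrite addn1 /= LP.
  - by rewrite RP.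
  - by rewrite subn1 RP.
exact: (chain_Gorenstein wP).
Qed.

End Splicing.

(** * Adjoint functors *)

Record functor (C D : category) := Functor {
  fobj :> C -> D;
  fmap : forall a b : C, cat_hom a b -> cat_hom (fobj a) (fobj b);
  fmap1 : forall a, fmap (cat_id a) = cat_id (fobj a);
  fmapM : forall a b c (g : cat_hom b c) (f : cat_hom a b),
    fmap (g \c f) = fmap g \c fmap f;
  fmap0 : forall a b, fmap (cat_zero a b) = cat_zero (fobj a) (fobj b)
}.
Arguments fmap {C D} f {a b} h : rename.

Record adjunction (C D : category) (L : functor C D) (F : functor D C) := Adjunction {
  adj : forall a b, cat_hom (L a) b -> cat_hom a (F b);
  adjV : forall a b, cat_hom a (F b) -> cat_hom (L a) b;
  adjK : forall a b (f : cat_hom (L a) b), adjV (adj f) = f;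
  adjVK : forall a b (f : cat_hom a (F b)), adj (adjV f) = f;
  adj_natl : forall a a' b (f : cat_hom (L a') b) (g : cat_hom a a'),
    adj (f \c fmap L g) = adj f \c g;
  adj_natr : forall a b b' (h : cat_hom b b') (f : cat_hom (L a) b),
    adj (h \c f) = fmap F h \c adj f
}.
Arguments adj {C D L F} a0 {a b} f : rename.
Arguments adjV {C D L F} a0 {a b} f : rename.

Definition preserves_epi (C D : category) (F : functor C D) : Prop :=
  forall a b (e : cat_hom a b), is_epi e -> is_epi (fmap F e).
Definition preserves_kernel (C D : category) (F : functor C D) : Prop :=
  forall a b k (g : cat_hom a b) (i : cat_hom k a),
    is_kernel g i -> is_kernel (fmap F g) (fmap F i).
Definition preserves_projective (C D : category) (F : functor C D) : Prop :=
  forall p : C, is_projective p -> is_projective (F p).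

Section AdjunctionTheory.
Variables (C D : category) (L : functor C D) (F : functor D C).
Variable A : adjunction L F.

Lemma adj_inj a b (f g : cat_hom (L a) b) : adj A f = adj A g -> f = g.
Proof. by move=> fg; rewrite -[f](adjK A) fg adjK. Qed.

Lemma adjV_natr a b b' (h : cat_hom b b') (f : cat_hom a (F b)) :
  h \c adjV A f = adjV A (fmap F h \c f).
Proof. by apply: adj_inj; rewrite adj_natr !adjVK. Qed.

Lemma adjV_natl a a' b (f : cat_hom a' (F b)) (g : cat_hom a a') :
  adjV A f \c fmap L g = adjV A (f \c g).
Proof. by apply: adj_inj; rewrite adj_natl !adjVK. Qed.

Lemma adj0 a b : adj A (cat_zero (L a) b) = cat_zero a (F b).
Proof.
by rewrite -[cat_zero (L a) b](cat_comp0m b (cat_zero (L a) b)) adj_natr fmap0 cat_comp0m.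
Qed.

Lemma adjV0 a b : adjV A (cat_zero a (F b)) = cat_zero (L a) b.
Proof. by rewrite -adj0 adjK. Qed.

Lemma left_adjoint_epi : preserves_epi L.
Proof.
move=> a b e eE c u v uv; apply: adj_inj; apply: eE.
by rewrite -!adj_natl uv.
Qed.

Lemma right_adjoint_kernel : preserves_kernel F.
Proof.
move=> a b k g i [gi0 univ]; split=> [|c h gh0]; first by rewrite -fmapM gi0 fmap0.
have [|u [iu uuniq]] := univ (L c) (adjV A h).
  by rewrite adjV_natr gh0 adjV0.
exists (adj A u); split=> [|v iv]; first by rewrite -adj_natr iu adjVK.
by rewrite (uuniq (adjV A v)) ?adjVK // adjV_natr iv.
Qed.

Lemma left_adjoint_projective : preserves_epi F -> preserves_projective L.
Proof.
move=> Fepi p pproj a b e f /Fepi eE; have [g Fg] := pproj _ _ _ (adj A f) eE.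
by exists (adjV A g); rewrite adjV_natr Fg adjK.
Qed.

(** Applied to the identity this says that the counit of an adjunction with
    faithful right adjoint is epi. *)
Lemma adjV_epi a b (e : cat_hom a (F b)) :
  (forall c (u v : cat_hom b c), fmap F u = fmap F v -> u = v) ->
  is_epi e -> is_epi (adjV A e).
Proof.
move=> Ffaithful eE c u v uv; apply: Ffaithful; apply: eE.
by rewrite -[LHS](adjVK A) -[RHS](adjVK A) -!adjV_natr uv.
Qed.

(** Adjointness turns Ext^1 with values in F q into Ext^1 with values in q. *)
Lemma extends_along_adj a b (i : cat_hom a b) q :
  extends_along (fmap L i) q -> extends_along i (F q).
Proof.
move=> ext f; have [g gi] := ext (adjV A f).
by exists (adj A g); rewrite -adj_natl gi adjVK.
Qed.

End AdjunctionTheory.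

Definition functor_comp (C D E : category) (G : functor D E) (F : functor C D) : functor C E.
Proof.
refine (@Functor C E (fun a => G (F a)) (fun a b f => fmap G (fmap F f)) _ _ _).
- by move=> a; rewrite !fmap1.
- by move=> *; rewrite !fmapM.
- by move=> *; rewrite !fmap0.
Defined.

Definition adjunction_comp (C D E : category) (L : functor C D) (F : functor D C)
    (L' : functor D E) (F' : functor E D) (A : adjunction L F) (A' : adjunction L' F') :
  adjunction (functor_comp L' L) (functor_comp F F').
Proof.
refine (@Adjunction _ _ (functor_comp L' L) (functor_comp F F')
  (fun a b f => adj A (adj A' f)) (fun a b f => adjV A' (adjV A f)) _ _ _ _) => /=.
- by move=> *; rewrite !adjK.
- by move=> *; rewrite !adjVK.
- by move=> *; rewrite !adj_natl.
- by move=> *; rewrite !adj_natr.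
Defined.

Section AdjointTriple.
Variables (C D : category) (L : functor C D) (F : functor D C) (G : functor C D).
Variables (A : adjunction L F) (B : adjunction F G).

(** F is a left adjoint, so it preserves epimorphisms, and L preserves
    projectives; since G preserves epimorphisms, F preserves projectives.
    A cocycle on L P with values in a projective q is transposed to a cocycle on P
    with values in the projective F q, where it is a coboundary. *)
Theorem Gorenstein_projective_adjoint (m : C) :
  preserves_kernel L -> preserves_epi G ->
  Gorenstein_projective m -> Gorenstein_projective (L m).
Proof.
move=> Lker Gepi [P [acP projP homP [i iK]]].
have Fepi : preserves_epi F := left_adjoint_epi B.
have diffL j k l (jk : j = k + 1) (kl : k = l + 1) :
    fmap L (cc_diff P kl) \c fmap L (cc_diff P jk) = cat_zero (L (P j)) (L (P l)).
  by rewrite -fmapM cc_diff_comp fmap0.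
exists (ChainComplex diffL); split=> [j k l jk kl|n|q qproj j k l jk kl f fd0|].
- have [z [iz [e [izK eE de]]]] := acP j k l jk kl.
  exists (L z), (fmap L iz), (fmap L e); split.
  + exact: Lker.
  + exact: (left_adjoint_epi A).
  + by rewrite /= de fmapM.
- by apply: (left_adjoint_projective A).
- have Fq : is_projective (F q) by apply: (left_adjoint_projective B).
  have [|g gd] := homP _ Fq j k l jk kl (adj A f).
    by rewrite -adj_natl (fd0 : f \c fmap L _ = _) adj0.
  by exists (adjV A g); rewrite /= adjV_natl gd adjK.
- by exists (fmap L i); apply: Lker.
Qed.

End AdjointTriple.

(** * Submodules, quotients and finitely supported families *)

Definition to_linear (S : pzRingType) (U V : lmodType S) (f : U -> V)
    (fL : forall a u v, f (a *: u + v) = a *: f u + f v) : {linear U -> V} :=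
  HB.pack f (GRing.isLinear.Build S U V *:%R f fL).

Lemma linear_of (S : pzRingType) (U V : lmodType S) (f : U -> V) :
  (forall a u v, f (a *: u + v) = a *: f u + f v) ->
  {g : {linear U -> V} | forall u, g u = f u}.
Proof. by move=> fL; exists (to_linear fL). Qed.

Definition onto (U V : Type) (f : U -> V) : Prop := forall v, exists u, f u = v.

Section Submodules.
Variables (S : pzRingType) (U : lmodType S).

Record submodule := Submodule {
  submod_mem :> U -> Prop;
  submod_mem0 : submod_mem 0;
  submod_memL : forall a u v, submod_mem u -> submod_mem v -> submod_mem (a *: u + v)
}.

Variable N : submodule.
Definition submod_pred : {pred U} := fun u => `[< N u >].
Fact submod_pred_closed : submod_closed submod_pred.
Proof.
split=> [|a u v /asboolP Nu /asboolP Nv]; apply/asboolP.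
  exact: submod_mem0.
exact: submod_memL.
Qed.
HB.instance Definition _ := GRing.isSubmodClosed.Build S U submod_pred
  (GRing.submod_closed_semi submod_pred_closed).

Definition submod : Type := {u : U | u \in submod_pred}.
HB.instance Definition _ := SubType.on submod.
HB.instance Definition _ := [Choice of submod by <:].
HB.instance Definition _ := [SubChoice_isSubLmodule of submod by <:].

Lemma submodP (x : submod) : N (val x).
Proof. exact/asboolP/(valP x). Qed.
Definition in_submod u (Nu : N u) : submod := exist _ u (introT (asboolP _) Nu).

Local Open Scope quotient_scope.

Definition quomod : Type := Quotient.quot submod_pred.
HB.instance Definition _ := GRing.Zmodule.on quomod.
HB.instance Definition _ := Quotient.on quomod.

Lemma quomod_eq u v : (\pi_quomod u = \pi_quomod v) <-> N (u - v).
Proof.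
split=> [/eqP|Nuv]; first by rewrite -Quotient.idealrBE => /asboolP.
by apply/eqP; rewrite -Quotient.idealrBE; apply/asboolP.
Qed.

Lemma quomod_piD : {morph \pi_quomod : u v / u + v}.
Proof. exact: (@raddfD _ _ \pi_(Quotient.quot submod_pred)). Qed.

Lemma submod_memZ a u : N u -> N (a *: u).
Proof. by move=> Nu; rewrite -[_ *: u]addr0; apply/submod_memL/submod_mem0. Qed.

(** The quotient group carries a module structure because a submodule is stable
    under scaling ([quomod_piZ]). *)
Definition quomod_scale (a : S) (x : quomod) : quomod := \pi_quomod (a *: repr x).

Lemma quomod_piZ a u : \pi_quomod (a *: u) = quomod_scale a (\pi_quomod u).
Proof.
apply/quomod_eq; rewrite -scalerBr; apply: submod_memZ.
by apply/quomod_eq; rewrite reprK.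
Qed.

Fact quomod_scaleA a b x :
  quomod_scale a (quomod_scale b x) = quomod_scale (a * b) x.
Proof. by rewrite -(reprK x) -(quomod_piZ b) -!quomod_piZ scalerA. Qed.
Fact quomod_scale1 : left_id 1 quomod_scale.
Proof. by move=> x; rewrite -(reprK x) -quomod_piZ scale1r. Qed.
Fact quomod_scaleDr : right_distributive quomod_scale +%R.
Proof.
move=> a x y; rewrite -(reprK x) -(reprK y) -quomod_piD -!quomod_piZ.
by rewrite scalerDr quomod_piD.
Qed.
Fact quomod_scaleDl x : {morph quomod_scale^~ x : a b / a + b}.
Proof.
by move=> a b; rewrite -(reprK x) -!quomod_piZ scalerDl quomod_piD.
Qed.
HB.instance Definition _ := GRing.Zmodule_isLmodule.Build S quomod
  quomod_scaleA quomod_scale1 quomod_scaleDr quomod_scaleDl.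

Lemma quotient_exists :
  exists (Q : lmodType S) (p : {linear U -> Q}), onto p /\ forall u, p u = 0 <-> N u.
Proof.
have [a u v|p pE] := @linear_of S U quomod (\pi_quomod).
  by rewrite quomod_piD quomod_piZ.
exists quomod, p; split=> [x|u].
  by exists (repr x); rewrite pE reprK.
by have := quomod_eq u 0; rewrite subr0 -!pE raddf0.
Qed.

End Submodules.

Section LinearMaps.
Variable S : pzRingType.
Implicit Types (U V W X P Q K : lmodType S).

Lemma lker_closed U V (f : {linear U -> V}) (a : S) u v :
  f u = 0 -> f v = 0 -> f (a *: u + v) = 0.
Proof. by rewrite linearP => -> ->; rewrite scaler0 addr0. Qed.
Definition lker_submodule U V (f : {linear U -> V}) : submodule U :=
  Submodule (raddf0 f) (lker_closed (f := f)).

Fact limg0 U V (f : {linear U -> V}) : exists u, f u = 0.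
Proof. by exists 0; rewrite raddf0. Qed.
Fact limgL U V (f : {linear U -> V}) (a : S) v w :
  (exists u, f u = v) -> (exists u, f u = w) -> exists u, f u = a *: v + w.
Proof. by move=> [u <-] [u' <-]; exists (a *: u + u'); rewrite linearP. Qed.
Definition limg_submodule U V (f : {linear U -> V}) : submodule V :=
  Submodule (limg0 f) (limgL (f := f)).

(** Short exactness, on elements. *)
Definition lexact U V W (i : {linear U -> V}) (p : {linear V -> W}) : Prop :=
  [/\ injective i, onto p & forall v, p v = 0 <-> exists u, i u = v].

Lemma lexact_comp0 U V W (i : {linear U -> V}) (p : {linear V -> W}) u :
  lexact i p -> p (i u) = 0.
Proof. by move=> [_ _ ex]; apply/ex; exists u. Qed.

Lemma lexact_lift U V W X (i : {linear U -> V}) (p : {linear V -> W})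
    (f : {linear X -> V}) :
  lexact i p -> (forall x, p (f x) = 0) ->
  exists g : {linear X -> U}, forall x, i (g x) = f x.
Proof.
move=> [inj _ ex] pf0.
have [g gP] := choice (fun x => proj1 (ex (f x)) (pf0 x)).
have [a x y|h hE] := @linear_of S X U g.
  by apply: inj; rewrite linearP !gP linearP.
by exists h => x; rewrite hE gP.
Qed.

Lemma lexact_factor U V W X (i : {linear U -> V}) (p : {linear V -> W})
    (f : {linear V -> X}) :
  lexact i p -> (forall u, f (i u) = 0) ->
  exists g : {linear W -> X}, forall v, g (p v) = f v.
Proof.
move=> [_ sur ex] fi0.
have f_eq v v' : p v = p v' -> f v = f v'.
  move=> pvv'; apply/eqP; rewrite -subr_eq0 -linearB.
  have /ex[u <-] : p (v - v') = 0 by rewrite linearB pvv' subrr.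
  by rewrite fi0.
have [s sP] := choice sur.
have [a x y|h hE] := @linear_of S W X (f \o s).
  by rewrite /= -linearP; apply: f_eq; rewrite linearP !sP.
by exists h => v; rewrite hE; apply: f_eq; rewrite sP.
Qed.

Lemma kernel_exists U V (f : {linear U -> V}) :
  exists (K : lmodType S) (i : {linear K -> U}),
    injective i /\ forall u, f u = 0 <-> exists k, i k = u.
Proof.
pose N := lker_submodule f.
exists (submod N), (val : {linear submod N -> U}); split; first exact: val_inj.
move=> u; split=> [fu0|[k <-]]; last exact: (submodP k).
by exists (@in_submod _ _ N u fu0).
Qed.

(** An epimorphism cannot tell the projection to its cokernel from zero. *)
Lemma Mod_epiP U V (e : {linear U -> V}) : @is_epi (Mod S) U V e <-> onto e.
Proof.
split=> [eE|eO W f g fg]; last first.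
  apply: linear_ext => v; have [u <-] := eO v.
  exact: (congr1 (fun h : {linear U -> W} => h u) fg).
have [Q [p [_ pE]]] := quotient_exists (limg_submodule e).
have p0 : p = linear_zero V Q.
  by apply: eE; apply: linear_ext => u /=; apply/pE; exists u.
by move=> v; apply/(pE v); rewrite p0.
Qed.

Lemma Mod_kernelP U V K (g : {linear U -> V}) (i : {linear K -> U}) :
  @is_kernel (Mod S) U V K g i <->
  injective i /\ forall u, g u = 0 <-> exists k, i k = u.
Proof.
split=> [iK|[inj ex]].
  have [gi0 univ] := iK.
  have gi k : g (i k) = 0 by exact: (congr1 (fun h : {linear K -> V} => h k) gi0).
  split=> [|u].
    have [K' [j [_ jE]]] := kernel_exists i.
    have j0 : j = linear_zero K' K.
      apply: (kernel_mono iK); apply: linear_ext => k /=.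
      by rewrite raddf0; apply/jE; exists k.
    apply: raddf_inj => k /jE[k' <-].
    by rewrite j0.
  split=> [gu0|[k <-]//].
  have [K' [j [_ jE]]] := kernel_exists g.
  have [|f [fE _]] := univ K' j.
    by apply: linear_ext => k /=; apply/jE; exists k.
  have /jE[k ku] := gu0; exists (f k); rewrite -ku.
  exact: (congr1 (fun h : {linear K' -> U} => h k) fE).
have gi k : g (i k) = 0 by apply/ex; exists k.
split=> [|W h gh0]; first exact: linear_ext.
have gh w : g (h w) = 0 by exact: (congr1 (fun h : {linear W -> V} => h w) gh0).
have [f fP] := choice (fun w => proj1 (ex (h w)) (gh w)).
have [a x y|f' f'E] := @linear_of S W K f.
  by apply: inj; rewrite linearP !fP linearP.
exists f'; split=> [|f'' f''E]; first by apply: linear_ext => w /=; rewrite f'E fP.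
apply: linear_ext => w; apply: inj; rewrite f'E fP -f''E //.
Qed.

Definition lprojective P : Prop :=
  forall U V (e : {linear U -> V}) (f : {linear P -> V}), onto e ->
    exists g : {linear P -> U}, forall x, e (g x) = f x.

Lemma Mod_projectiveP P : @is_projective (Mod S) P <-> lprojective P.
Proof.
split=> [proj U V e f /Mod_epiP/(proj _ _ _ f)[g eg]|proj U V e f /Mod_epiP eO].
  by exists g => x; rewrite -eg.
by have [g eg] := proj _ _ _ f eO; exists g; apply: linear_ext.
Qed.

Lemma lprojective_prod P Q :
  lprojective P -> lprojective Q -> lprojective (P * Q)%type.
Proof.
move=> Pproj Qproj U V e f eO.
have [a x y|f1 f1E] := @linear_of S P V (fun x => f (x, 0)).
  by rewrite -linearP; congr (f (_, _)); rewrite /= scaler0 addr0.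
have [a x y|f2 f2E] := @linear_of S Q V (fun x => f (0, x)).
  by rewrite -linearP; congr (f (_, _)); rewrite /= scaler0 addr0.
have [g1 g1E] := Pproj _ _ _ f1 eO; have [g2 g2E] := Qproj _ _ _ f2 eO.
have [a x y|g gE] := @linear_of S (P * Q)%type U (fun x => g1 x.1 + g2 x.2).
  by rewrite /= !linearP scalerDr addrACA.
exists g => -[x y]; rewrite gE linearD g1E g2E f1E f2E -linearD.
by congr (f (_, _)); rewrite /= ?addr0 ?add0r.
Qed.

End LinearMaps.

Section FiniteSupport.
Variable I : choiceType.

(** Finite support is a mere existence statement; [fsum] returns the expected
    sum on such families and the default value 0 on all others. *)
Definition finsupp (V : nmodType) (f : I -> V) : Prop :=
  exists s : seq I, forall i, i \notin s -> f i = 0.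

Definition fsum (V : nmodType) (f : I -> V) : V := \sum_(i \in [set: I]) f i.

Lemma fsum_seq (V : nmodType) (f : I -> V) (s : seq I) :
  uniq s -> (forall i, i \notin s -> f i = 0) -> fsum f = \sum_(i <- s) f i.
Proof.
move=> us fs; rewrite (@bigfs _ _ _ _ s predT) //; last by move=> i _; exact: fs.
by apply: eq_fsbigl; apply/seteqP.
Qed.

Lemma finsupp_uniq (V : nmodType) (f : I -> V) : finsupp f ->
  exists s, uniq s /\ forall i, i \notin s -> f i = 0.
Proof.
move=> [s fs]; exists (undup s); split; first exact: undup_uniq.
by move=> i; rewrite mem_undup; apply: fs.
Qed.

Lemma fsum1 (V : nmodType) (f : I -> V) i :
  (forall j, j != i -> f j = 0) -> fsum f = f i.
Proof. by move=> fi; rewrite (@fsum_seq _ _ [:: i]) ?big_seq1 // => j; rewrite inE => /fi. Qed.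

Lemma finsupp1 (V : nmodType) (f : I -> V) i :
  (forall j, j != i -> f j = 0) -> finsupp f.
Proof. by move=> fi; exists [:: i] => j; rewrite inE => /fi. Qed.

Lemma fsum_map (S : pzRingType) (V W : lmodType S) (g : {linear V -> W}) (f : I -> V) :
  finsupp f -> g (fsum f) = fsum (fun i => g (f i)).
Proof.
move=> /finsupp_uniq[s [us fs]]; rewrite !(@fsum_seq _ _ s) ?linear_sum //.
by move=> i /fs ->; rewrite linear0.
Qed.

Lemma finsuppL (S : pzRingType) (V : lmodType S) (a : S) (f g : I -> V) :
  finsupp f -> finsupp g -> finsupp (a *: f + g).
Proof.
move=> [s fs] [t gt]; exists (s ++ t) => i; rewrite mem_cat negb_or => /andP[/fs fi /gt gi].
by rewrite -[LHS]/(a *: f i + g i) fi gi scaler0 addr0.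
Qed.

Lemma fsumL (S : pzRingType) (V : lmodType S) (a : S) (f g : I -> V) :
  finsupp f -> finsupp g -> fsum (fun i => a *: f i + g i) = a *: fsum f + fsum g.
Proof.
move=> [s fs] [t gt]; pose r := undup (s ++ t).
have rN i : i \notin r -> (f i = 0) * (g i = 0).
  by rewrite mem_undup mem_cat negb_or => /andP[/fs fi /gt gi].
rewrite !(@fsum_seq _ _ r) ?undup_uniq ?scaler_sumr ?big_split //;
  by move=> i /rN[fi gi]; rewrite ?fi ?gi ?scaler0 ?addr0.
Qed.

End FiniteSupport.

Section FreeModule.
Variables (S : pzRingType) (W : lmodType S).

(** The free module on the underlying set of W. *)
Definition free_submodule : submodule (W -> S^o) :=
  @Submodule S (W -> S^o) (@finsupp W S^o)
    (ex_intro _ [::] (fun _ _ => erefl)) (@finsuppL W S S^o).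
Definition free_module : lmodType S := submod free_submodule.

Definition free_gen_fun (w : W) : W -> S^o := fun v => (v == w)%:R.
Lemma free_gen_finsupp w : finsupp (free_gen_fun w).
Proof. by apply: (@finsupp1 _ _ _ w) => v; rewrite /free_gen_fun => /negPf ->. Qed.
Definition free_gen w : free_module := @in_submod _ _ free_submodule _ (free_gen_finsupp w).

Lemma free_finsupp (x : free_module) : finsupp (val x : W -> S^o).
Proof. exact: (@submodP _ _ free_submodule x). Qed.

Lemma free_scale_finsupp (x : free_module) (V : lmodType S) (f : W -> V) :
  finsupp (fun w => (val x w : S) *: f w).
Proof.
by have [s xs] := free_finsupp x; exists s => w /xs ->; rewrite scale0r.
Qed.

Lemma free_map_exists (V : lmodType S) (f : W -> V) :
  exists g : {linear free_module -> V},
    forall x, g x = fsum (fun w => (val x w : S) *: f w).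
Proof.
have [a x y|g gE] := @linear_of S free_module V (fun x => fsum (fun w => (val x w : S) *: f w)).
  rewrite -fsumL; try exact: free_scale_finsupp.
  by congr (fsum _); apply/funext => w; rewrite scalerA -scalerDl.
by exists g.
Qed.

Lemma free_sum (x : free_module) : x = fsum (fun w => (val x w : S) *: free_gen w).
Proof.
apply: val_inj; apply/funext => v.
have [a y z|ev evE] := @linear_of S free_module S^o (fun y => (val y : W -> S^o) v) => //.
rewrite -!evE (fsum_map ev (free_scale_finsupp x free_gen)) (@fsum1 _ _ _ v).
  by rewrite !evE -[RHS]/((val x v : S) * (v == v)%:R) eqxx mulr1.
move=> w /negPf wv.
by rewrite evE -[LHS]/((val x w : S) * (v == w)%:R) eq_sym wv mulr0.
Qed.

(** A map out of the free module lifts as soon as its values on the generators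
    do. *)
Lemma free_module_projective : lprojective free_module.
Proof.
move=> U V e f eO.
have [s sE] := choice (fun w => eO (f (free_gen w))).
have [g gE] := free_map_exists s; exists g => x.
rewrite [in RHS](free_sum x) gE !fsum_map; try exact: free_scale_finsupp.
by congr (fsum _); apply/funext => w; rewrite !linearZ /= sE.
Qed.

Lemma enough_projectives :
  exists (P : lmodType S) (p : {linear P -> W}), lprojective P /\ onto p.
Proof.
have [p pE] := free_map_exists id.
exists free_module, p; split=> [|w]; first exact: free_module_projective.
exists (free_gen w); rewrite pE (@fsum1 _ _ _ w) /= /free_gen_fun ?eqxx ?scale1r //.
by move=> v /negPf ->; rewrite scale0r.
Qed.
End FreeModule.

(** * Stable retracts of syzygies *)

Section StableRetracts.
Variable S : pzRingType.
Implicit Types (V W G K T P Q : lmodType S).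

(** V is a retract of G in the category of modules modulo the maps that factor
    through a projective; equivalently, V is a direct summand of the sum of G and
    a projective module.  The relation passes to kernels and cokernels in short exact
    sequences with projective middle terms. *)
Definition stable_retract V G : Prop :=
  exists P (a : {linear V -> G}) (b : {linear G -> V})
    (c : {linear V -> P}) (d : {linear P -> V}),
    lprojective P /\ forall v, v = b (a v) + d (c v).

(** Stated for all projective targets at once, as in the condition on a complete
    resolution. *)
Definition lextends V W (i : {linear V -> W}) : Prop :=
  forall Q (f : {linear V -> Q}), lprojective Q ->
    exists g : {linear W -> Q}, forall v, g (i v) = f v.

(** The embedding is j = (k a, c).  If id = b a + d c, then j v = 0 forces
    a v = 0 and c v = 0, so v = 0.  A map f is f b a + f d c, where f b extends
    along k; so f extends along j. *)
Lemma stable_retract_embedding V G P (k : {linear G -> P}) :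
  stable_retract V G -> lprojective P -> injective k -> lextends k ->
  exists P' (j : {linear V -> P'}), [/\ lprojective P', injective j & lextends j].
Proof.
move=> [P0 [a [b [c [d [P0proj vE]]]]]] Pproj kinj kext.
have [x u v|j jE] := @linear_of S V (P * P0)%type (fun v => (k (a v), c v)).
  by rewrite !linearP.
exists (P * P0)%type, j; split=> [|u v|Q f Qproj]; first exact: lprojective_prod.
  by rewrite !jE => -[/kinj auv cuv]; rewrite [u]vE [v]vE auv cuv.
have [g gk] := kext Q (f \o b) Qproj.
have [x u v|h hE] := @linear_of S (P * P0)%type Q (fun x => g x.1 + f (d x.2)).
  by rewrite /= !linearP scalerDr addrACA.
by exists h => v; rewrite hE jE gk /= -linearD -vE.
Qed.

(** The maps a, b and c extend to at_ : T -> P, bt : P -> T and ct : T -> P0,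
    and at_, bt induce a', b' on cokernels.  The map id - bt at_ - i d ct vanishes
    on V, so it factors as h' p; composing with p shows that id - b' a' = p h'
    on V', a map that factors through the projective T. *)
Lemma stable_retract_cosyzygy V T V' G P G'
    (i : {linear V -> T}) (p : {linear T -> V'})
    (k : {linear G -> P}) (q : {linear P -> G'}) :
  lexact i p -> lprojective T -> lextends i ->
  lexact k q -> lprojective P -> lextends k ->
  stable_retract V G -> stable_retract V' G'.
Proof.
move=> ip Tproj iext kq Pproj kext [P0 [a [b [c [d [P0proj vE]]]]]].
have [at_ atE] := iext _ (k \o a) Pproj.
have [bt btE] := kext _ (i \o b) Tproj.
have [ct ctE] := iext _ c P0proj.
have [v|a' a'E] := lexact_factor (f := q \o at_) ip.
  by rewrite /= atE /= (lexact_comp0 _ kq).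
have [g|b' b'E] := lexact_factor (f := p \o bt) kq.
  by rewrite /= btE /= (lexact_comp0 _ ip).
have [x u v|h hE] := @linear_of S T T (fun t => t - (bt (at_ t) + i (d (ct t)))).
  by rewrite !linearP addrACA -scalerDr opprD -scalerN [LHS]addrACA -scalerDr.
have [v|h' h'E] := lexact_factor (f := h) ip.
  by rewrite hE atE /= btE /= ctE -linearD -vE subrr.
have [_ pO _] := ip.
exists T, a', b', h', p; split=> // v'; have [t <-] := pO v'.
rewrite a'E /= b'E /= h'E hE linearB linearD (lexact_comp0 _ ip) addr0.
by rewrite addrC subrK.
Qed.

(** Dually, lift a, b and d to at_ : T -> P, bt : P -> T and dt : P0 -> T.  Then
    id - bt at_ - dt c p has its values in K, say h', and id - b' a' = h' i on K
    factors through the projective T.  The same identity transfers the extension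
    property: f = (f b') a' + f h' i, where f b' extends along k. *)
Lemma stable_retract_syzygy K T V G' P G
    (i : {linear K -> T}) (p : {linear T -> V})
    (k : {linear G' -> P}) (q : {linear P -> G}) :
  lexact i p -> lprojective T -> lexact k q -> lprojective P ->
  stable_retract V G -> stable_retract K G' /\ (lextends k -> lextends i).
Proof.
move=> ip Tproj kq Pproj [P0 [a [b [c [d [P0proj vE]]]]]].
have [[iinj pO _] [_ qO _]] := (ip, kq).
have [at_ atE] := Tproj _ _ q (a \o p) qO.
have [bt btE] := Pproj _ _ p (b \o q) pO.
have [dt dtE] := P0proj _ _ p d pO.
have [x|a' a'E] := lexact_lift (f := at_ \o i) kq.
  by rewrite /= atE /= (lexact_comp0 _ ip) raddf0.
have [x|b' b'E] := lexact_lift (f := bt \o k) ip.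
  by rewrite /= btE /= (lexact_comp0 _ kq) raddf0.
have [x u v|h hE] := @linear_of S T T (fun t => t - (bt (at_ t) + dt (c (p t)))).
  by rewrite !linearP addrACA -scalerDr opprD -scalerN [LHS]addrACA -scalerDr.
have [t|h' h'E] := lexact_lift (f := h) ip.
  by rewrite hE linearB linearD btE /= atE dtE /= -vE subrr.
have xE x : x = b' (a' x) + h' (i x).
  apply: iinj; rewrite linearD b'E /= a'E /= h'E hE (lexact_comp0 _ ip).
  by rewrite !linear0 addr0 addrC subrK.
split=> [|kext Q f Qproj]; first by exists T, a', b', i, h'.
have [g gE] := kext _ (f \o b') Qproj.
have [x u v|F FE] := @linear_of S T Q (fun t => g (at_ t) + f (h' t)).
  by rewrite !linearP addrACA -scalerDr.
by exists F => x; rewrite FE -[at_ _]a'E gE /= -linearD -xE.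
Qed.

End StableRetracts.

Section Cycles.
Variables (S : pzRingType) (P : chain_complex (Mod S)).
Hypothesis acP : acyclic P.
Hypothesis homP : forall q, is_projective q -> hom_acyclic P q.
Implicit Types Z : lmodType S.

Definition term (n : int) : lmodType S := P n.
Definition diff (i j : int) (ij : i = j + 1) : {linear term i -> term j} := cc_diff P ij.

Lemma diff_comp (i j k : int) (ij : i = j + 1) (jk : j = k + 1) x : diff jk (diff ij x) = 0.
Proof.
have dd0 : linear_comp (diff jk) (diff ij) = linear_zero _ _ := cc_diff_comp P ij jk.
exact: (congr1 (fun h : {linear term i -> term k} => h x) dd0).
Qed.

Lemma diff_exact (i j k : int) (ij : i = j + 1) (jk : j = k + 1) y :
  diff jk y = 0 -> exists x, diff ij x = y.
Proof.
have [z [iz [e [/Mod_kernelP[_ izE] /Mod_epiP eO dE]]]] := acP ij jk.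
move=> /izE[u <-]; have [x <-] := eO u; exists x.
exact: (congr1 (fun h : {linear term i -> term j} => h x) dE).
Qed.

Definition cycle n Z (i : {linear Z -> term n}) : Prop :=
  injective i /\
  forall k (nk : n = k + 1) x, diff nk x = 0 <-> exists z, i z = x.

Lemma cycle_onto (j : int) Z (iz : {linear Z -> term j}) (i : int) (ij : i = j + 1) :
  cycle iz -> exists p : {linear term i -> Z}, onto p /\ forall x, iz (p x) = diff ij x.
Proof.
move=> [inj izE].
have jk : j = (j - 1) + 1 by rewrite subrK.
have [p pP] := choice (fun x => proj1 (izE _ jk _) (diff_comp ij jk x)).
have [a x y|f fE] := @linear_of S (term i) Z p.
  by apply: inj; rewrite linearP !pP linearP.
exists f; split=> [z|x]; last by rewrite fE pP.
have [|x xE] := diff_exact ij (jk := jk) (y := iz z); first by apply/izE; exists z.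
by exists x; apply: inj; rewrite fE pP.
Qed.

(** The extension property is the acyclicity of Hom(P, Q): f on Z = Z_i gives the
    cocycle f p on P_(i+1), where p : P_(i+1) -> Z_i is the corestriction of the
    differential. *)
Lemma cycle_exact (i j : int) (ij : i = j + 1) Z Z'
    (iz : {linear Z -> term i}) (iz' : {linear Z' -> term j}) :
  cycle iz -> cycle iz' ->
  lextends iz /\ exists p : {linear term i -> Z'}, lexact iz p.
Proof.
move=> zC z'C; split.
  move=> Q f /Mod_projectiveP Qproj.
  have [p [pO pE]] := cycle_onto (erefl (i + 1)) zC.
  have [|g gE] := @homP Q Qproj (i + 1 + 1) (i + 1) i erefl erefl (linear_comp f p).
    apply: linear_ext => x /=.
    suff -> : p (diff (erefl (i + 1 + 1)) x) = 0 by rewrite raddf0.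
    by have [inj _] := zC; apply: inj; rewrite pE diff_comp raddf0.
  exists g => z; have [x <-] := pO z.
  by rewrite pE; exact: (congr1 (fun h : {linear term (i + 1) -> Q} => h x) gE).
have [p [pO pE]] := cycle_onto ij z'C.
have [[inj izE] [inj' _]] := (zC, z'C).
exists p; split=> // x; rewrite -(izE _ ij) -pE.
by split=> [->|px0]; [rewrite raddf0 | apply: inj'; rewrite px0 raddf0].
Qed.

Lemma cycle_exists n : exists Z (i : {linear Z -> term n}), cycle i.
Proof.
have nk : n = (n - 1) + 1 by rewrite subrK.
have [Z [i [inj iE]]] := kernel_exists (diff nk).
exists Z, i; split=> // k nk'.
have kE : k = n - 1 by rewrite nk' addrK.
by case: _ / (esym kE) nk' => nk'; rewrite (eq_irrelevance nk' nk).
Qed.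

End Cycles.

(** * Descending Gorenstein projectivity along a left adjoint *)

Section Reflection.
Variables (C : category) (S : pzRingType).
Variables (L : functor C (Mod S)) (F : functor (Mod S) C) (G : functor C (Mod S)).
Variables (A : adjunction L F) (B : adjunction F G).

(** L takes values in modules, so its values can be applied to elements. *)
Definition underlying a : lmodType S := L a.
Definition underlying_map a b (f : cat_hom a b) :
  {linear underlying a -> underlying b} := fmap L f.

Hypothesis Gepi : preserves_epi G.
Hypothesis Gfaithful : forall a b (u v : cat_hom a b), fmap G u = fmap G v -> u = v.
Hypothesis quotients : forall a b (i : cat_hom a b), injective (underlying_map i) ->
  exists c (p : cat_hom b c),
    short_exact i p /\ lexact (underlying_map i) (underlying_map p).
Hypothesis kernels : forall b c (p : cat_hom b c), is_epi p ->
  exists a (i : cat_hom a b),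
    short_exact i p /\ lexact (underlying_map i) (underlying_map p).

Let Fproj : preserves_projective F := left_adjoint_projective B Gepi.
Let Lproj : preserves_projective L :=
  left_adjoint_projective A (left_adjoint_epi B).

(** The transpose of an epimorphism V -> G a with V projective. *)
Lemma enough_free a : exists (V : lmodType S) (e : cat_hom (F V) a),
  lprojective V /\ is_epi e.
Proof.
have [V [p [Vproj pO]]] := enough_projectives (G a : lmodType S).
exists V, (adjV B (p : @cat_hom (Mod S) V (G a))); split=> //.
by apply: adjV_epi; [exact: Gfaithful | apply/Mod_epiP].
Qed.

(** A projective q is a retract of some F V with V projective, and maps into F V
    are maps from the underlying modules into V. *)
Lemma extends_underlying a b (i : cat_hom a b) q :
  lextends (underlying_map i) -> is_projective q -> extends_along i q.
Proof.
move=> iext qproj f.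
have [V [e [Vproj eE]]] := enough_free q.
have [s es] := qproj _ _ e (cat_id q) eE.
have iextV : extends_along (fmap L i) (V : Mod S).
  move=> h; have [g gE] := iext V h Vproj.
  by exists g; apply: linear_ext.
have [g gE] := extends_along_adj A iextV (s \c f).
by exists (e \c g); rewrite -cat_compA gE cat_compA es cat_comp1m.
Qed.

(** The composite of L i with the counit L F P -> P is j.  Hence i is injective
    on underlying modules, and a map that extends along j extends along i. *)
Lemma embedding_adj a (P : lmodType S) (j : {linear underlying a -> P}) :
  injective j -> lextends j ->
  exists i : cat_hom a (F P), injective (underlying_map i) /\ lextends (underlying_map i).
Proof.
move=> jinj jext; exists (adj A (j : @cat_hom (Mod S) (L a) P)).
set i := adj A _.
pose counit : {linear underlying (F P) -> P} := adjV A (cat_id (F P)).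
have counitE x : counit (underlying_map i x) = j x.
  have <- : adjV A (cat_id (F P)) \c fmap L i = j.
    by rewrite adjV_natl cat_comp1m adjK.
  by [].
split=> [x y xy|Q f Qproj]; first by apply: jinj; rewrite -!counitE xy.
have [g gE] := jext Q f Qproj.
by exists (g \o counit) => x; rewrite /= counitE gE.
Qed.

(** The class of the objects whose underlying module is a stable retract of a
    cycle of a complete resolution of L m is closed under the syzygies and
    cosyzygies built from [enough_free] and [embedding_adj]. *)
Theorem Gorenstein_projective_reflect m :
  Gorenstein_projective (L m) -> Gorenstein_projective m.
Proof.
move=> [P [acP projP homP [i0 /Mod_kernelP[i0inj i0E]]]].
have tproj n : lprojective (term P n) by exact: (proj1 (Mod_projectiveP _) (projP n)).
pose X a := exists n (Z : lmodType S) (i : {linear Z -> term P n}),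
  cycle i /\ stable_retract (underlying a) Z.
apply: (Gorenstein_projective_of_class (X := X)) => [a [n [Z [i [iC aZ]]]]|a|].
- have [Z' [i' i'C]] := cycle_exists P (n - 1).
  have nk : n = n - 1 + 1 by rewrite subrK.
  have [iext [p ip]] := cycle_exact acP homP nk iC i'C.
  have [iinj _] := iC.
  have [P' [j [P'proj jinj jext]]] := stable_retract_embedding aZ (tproj n) iinj iext.
  have [k [kinj kext]] := embedding_adj jinj jext.
  have [c [q [kq kqL]]] := quotients kinj.
  have FP'proj : is_projective (F P') by apply/Fproj/Mod_projectiveP.
  have Xa : X a by exists n, Z, i.
  have Xc : X c.
    exists (n - 1), Z', i'; split=> //.
    apply: (stable_retract_cosyzygy kqL _ kext ip (tproj n) iext aZ).
    exact/Mod_projectiveP/Lproj.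
  by exists (Link kq FP'proj (fun _ => extends_underlying kext) Xa Xc).
- move=> [n [Z [i [iC aZ]]]].
  have [Z' [i' i'C]] := cycle_exists P (n + 1).
  have [i'ext [p i'p]] := cycle_exact acP homP (erefl (n + 1)) i'C iC.
  have [V [e [Vproj eE]]] := enough_free a.
  have [b [k [ke keL]]] := kernels eE.
  have FVproj : is_projective (F V) by apply/Fproj/Mod_projectiveP.
  have LFVproj : lprojective (underlying (F V)) by apply/Mod_projectiveP/Lproj.
  have [bZ' /(_ i'ext) kext] :=
    stable_retract_syzygy keL LFVproj i'p (tproj (n + 1)) aZ.
  have Xa : X a by exists n, Z, i.
  have Xb : X b by exists (n + 1), Z', i'.
  by exists (Link ke FVproj (fun _ => extends_underlying kext) Xb Xa).
- exists 0, (underlying m), i0; split.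
    split=> // k nk x.
    have kE : k = -1 by apply: (addIr 1); rewrite -nk.
    by move: nk; rewrite kE => nk; rewrite (eq_irrelevance nk erefl); apply: i0E.
  by exists (term P 0), idfun, idfun, \0, \0; split=> // v; rewrite /= addr0.
Qed.

End Reflection.

(** * Modules over the dual numbers *)

Section DualModules.
Variable R : pzRingType.
Local Notation A := (dual_num R).
Local Notation cst := (@dual_const R).
Local Notation X := (dual_x R).

Lemma dual_split (p : A) : p = cst p.1 + cst p.2 * X.
Proof.
case: p => a b; congr (_, _); rewrite /= !mulr0 ?mulr1 ?mul0r addr0 ?add0r //.
Qed.

Lemma dual_xC (a : R) : X * cst a = cst a * X.
Proof. by congr (_, _); rewrite /= !(mul0r, mulr0, mul1r, mulr1) ?add0r ?addr0. Qed.

Lemma dual_xx : X * X = 0.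
Proof. by congr (_, _); rewrite /= !(mul0r, mulr0) ?addr0. Qed.

Lemma dual_scale (N : lmodType A) (p : A) (n : N) :
  p *: n = cst p.1 *: n + cst p.2 *: (X *: n).
Proof. by rewrite {1}[p]dual_split scalerDl scalerA. Qed.

Lemma dual_xscale (N : lmodType A) (p : A) (n : N) :
  X *: (p *: n) = cst p.1 *: (X *: n).
Proof.
by rewrite (dual_scale p) scalerDr !scalerA !dual_xC -mulrA dual_xx mulr0 scale0r addr0.
Qed.

Definition restrict_map (N N' : lmodType A) (f : {linear N -> N'}) :
  {linear restriction cst N -> restriction cst N'} :=
  @to_linear R (restriction cst N) (restriction cst N') f
    (fun a u v => linearP f (cst a) u v).

Definition Restrict : functor (Mod A) (Mod R).
Proof.
refine (@Functor (Mod A) (Mod R) (fun N => restriction cst N : lmodType R)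
  restrict_map _ _ _); by move=> *; apply: linear_ext.
Defined.

(** The module V + x V; the pair (u, v) stands for u + x v. *)
Definition dual_ext (V : lmodType R) : Type := (V * V)%type.

Section DualExtension.
Variable V : lmodType R.
HB.instance Definition _ := GRing.Zmodule.on (dual_ext V).

Definition dual_ext_scale (p : A) (m : dual_ext V) : dual_ext V :=
  (p.1 *: m.1, p.1 *: m.2 + p.2 *: m.1).

Fact dual_ext_scaleA p q m :
  dual_ext_scale p (dual_ext_scale q m) = dual_ext_scale (p * q) m.
Proof.
by congr (_, _); rewrite /= ?scalerDr !scalerA // scalerDl addrA.
Qed.
Fact dual_ext_scale1 : left_id 1 dual_ext_scale.
Proof. by case=> u v; rewrite /dual_ext_scale /= !scale1r scale0r addr0. Qed.
Fact dual_ext_scaleDr : right_distributive dual_ext_scale +%R.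
Proof. by move=> p m n; congr (_, _); rewrite /= !scalerDr // addrACA. Qed.
Fact dual_ext_scaleDl m : {morph dual_ext_scale^~ m : p q / p + q}.
Proof. by move=> p q; congr (_, _); rewrite /= !scalerDl // addrACA. Qed.
HB.instance Definition _ := GRing.Zmodule_isLmodule.Build A (dual_ext V)
  dual_ext_scaleA dual_ext_scale1 dual_ext_scaleDr dual_ext_scaleDl.
End DualExtension.

Fact dual_ext_mapL (V W : lmodType R) (f : {linear V -> W}) (p : A) (m n : dual_ext V) :
  (f (p *: m + n).1, f (p *: m + n).2) =
  p *: ((f m.1, f m.2) : dual_ext W) + ((f n.1, f n.2) : dual_ext W).
Proof. by congr (_, _); rewrite /= !linearD !linearZ. Qed.
Definition dual_ext_map (V W : lmodType R) (f : {linear V -> W}) :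
  {linear dual_ext V -> dual_ext W} :=
  @to_linear A (dual_ext V) (dual_ext W) (fun m => (f m.1, f m.2)) (dual_ext_mapL f).

Definition Extend : functor (Mod R) (Mod A).
Proof.
refine (@Functor (Mod R) (Mod A) (fun V => dual_ext V : lmodType A)
  dual_ext_map _ _ _); by move=> *; apply: linear_ext => -[].
Defined.

Section ExtendLeftAdjoint.
Variables (V : lmodType R) (N : lmodType A).

Fact extend_adjL (f : {linear dual_ext V -> N}) (a : R) (u v : V) :
  f (a *: u + v, 0) =
  a *: (f (u, 0) : restriction cst N) + (f (v, 0) : restriction cst N).
Proof.
rewrite -[a *: (f _ : restriction _ _)]/(cst a *: f (u, 0)) -linearP.
by congr (f (_, _)); rewrite /= scaler0 scale0r !addr0.
Qed.
Definition extend_adj (f : {linear dual_ext V -> N}) :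
  {linear V -> restriction cst N} :=
  @to_linear R V (restriction cst N) (fun v => f (v, 0)) (extend_adjL f).

Fact extend_adjVL (g : {linear V -> restriction cst N}) (p : A) (m n : dual_ext V) :
  (g (p *: m + n).1 : N) + X *: (g (p *: m + n).2 : N) =
  p *: ((g m.1 : N) + X *: (g m.2 : N)) + ((g n.1 : N) + X *: (g n.2 : N)).
Proof.
rewrite /= !linearD !linearZ /= -![_ *: (g _ : restriction _ _)]/(cst _ *: (g _ : N)).
pose um : N := g m.1; pose vm : N := g m.2.
pose un : N := g n.1; pose vn : N := g n.2.
rewrite -[LHS]/(cst p.1 *: um + un + X *: (cst p.1 *: vm + cst p.2 *: um + vn)).
rewrite -[RHS]/(p *: (um + X *: vm) + (un + X *: vn)) [X *: (_ + vn)]scalerDr addrACA.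
congr (_ + _); rewrite (dual_scale p) !scalerDr !scalerA !dual_xC -[_ * X * X]mulrA.
by rewrite dual_xx mulr0 scale0r addr0 addrA.
Qed.
Definition extend_adjV (g : {linear V -> restriction cst N}) : {linear dual_ext V -> N} :=
  @to_linear A (dual_ext V) N (fun m => (g m.1 : N) + X *: (g m.2 : N)) (extend_adjVL g).
End ExtendLeftAdjoint.

(** Extension of scalars: an A-linear map is determined by its values on the
    summand V of V + x V. *)
Definition extend_restrict : adjunction Extend Restrict.
Proof.
refine (@Adjunction _ _ Extend Restrict extend_adj extend_adjV _ _ _ _).
- move=> V N f; apply: linear_ext => -[u v] /=.
  rewrite -linearZ -linearD; congr (f (_, _)) => /=.
    by rewrite !scale0r addr0.
  by rewrite !scale0r scale1r !add0r.
- by move=> V N f; apply: linear_ext => v /=; rewrite raddf0 scaler0 addr0.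
- by move=> V V' N f g; apply: linear_ext => v /=; rewrite raddf0.
- by move=> V N N' h f; apply: linear_ext.
Defined.

Section ExtendRightAdjoint.
Variables (N : lmodType A) (V : lmodType R).

Fact restrict_adjL (g : {linear restriction cst N -> V}) (p : A) (m n : N) :
  (g (X *: (p *: m + n)), g (p *: m + n)) =
  p *: ((g (X *: m), g m) : dual_ext V) + ((g (X *: n), g n) : dual_ext V).
Proof.
congr (_, _); rewrite /=.
  rewrite scalerDr dual_xscale.
  by rewrite -[cst p.1 *: _]/(p.1 *: (X *: m : restriction cst N)) linearP.
rewrite dual_scale -[cst p.1 *: _]/(p.1 *: (m : restriction cst N)).
rewrite -[cst p.2 *: _]/(p.2 *: (X *: m : restriction cst N)).
by rewrite linearD linearD !linearZ.
Qed.
Definition restrict_adj (g : {linear restriction cst N -> V}) : {linear N -> dual_ext V} :=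
  @to_linear A N (dual_ext V) (fun n => (g (X *: n), g n)) (restrict_adjL g).

Fact restrict_adjVL (h : {linear N -> dual_ext V}) (a : R) (m n : restriction cst N) :
  (h (a *: m + n)).2 = a *: (h m).2 + (h n).2.
Proof.
rewrite -[a *: m]/(cst a *: (m : N)) linearP /=.
by rewrite scale0r addr0.
Qed.
Definition restrict_adjV (h : {linear N -> dual_ext V}) : {linear restriction cst N -> V} :=
  @to_linear R (restriction cst N) V (fun n => (h n).2) (restrict_adjVL h).
End ExtendRightAdjoint.

(** Coextension of scalars: an A-linear map into V + x V is determined by its
    coefficient of x, because the constant coefficient of the image of n is the
    coefficient of x of the image of x n. *)
Definition restrict_extend : adjunction Restrict Extend.
Proof.
refine (@Adjunction _ _ Restrict Extend restrict_adj restrict_adjV _ _ _ _).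
- by move=> N V f; apply: linear_ext.
- move=> N V h; apply: linear_ext => n /=; rewrite linearZ /=.
  by case: (h n) => u v; congr (_, _); rewrite /= scale0r add0r scale1r.
- by move=> N N' V f g; apply: linear_ext => n /=; rewrite linearZ.
- by move=> N V V' h f; apply: linear_ext.
Defined.

End DualModules.

(** * Twisted families *)

Section Shift.
Variables (V : nmodType) (f : int -> V).

Lemma finsupp_shift : finsupp f -> finsupp (fun i => f (i - 1)).
Proof.
move=> [s fs]; exists [seq i + 1 | i <- s] => i iN; apply: fs.
by apply: contra iN => /(map_f (+%R^~ 1)); rewrite subrK.
Qed.

Lemma fsum_shift : fsum (fun i => f (i - 1)) = fsum f.
Proof.
rewrite /fsum [RHS](reindex_fsbigT (fun i : int => i - 1)) //.
by exists (fun i => i + 1) => i; rewrite ?addrK ?subrK.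
Qed.
End Shift.

Section Twist.
Variables (R : pzRingType) (Q : lmodType (dual_num R)).
Local Notation A := (dual_num R).
Local Notation cst := (@dual_const R).
Local Notation X := (dual_x R).

(** The family f stands for the formal sum of the f i t^i, over all integers i,
    on which x acts as x t.  The Laurent module and the product of the components
    of a graded module are both submodules of such a module, and taking components
    is a linear map into it ([gcomp_twist]). *)
Definition twist : Type := int -> Q.
HB.instance Definition _ := GRing.Zmodule.on twist.

Definition twist_scale (p : A) (f : twist) : twist :=
  fun i => cst p.1 *: f i + cst p.2 *: (X *: f (i - 1)).

Fact twist_scaleA p q f : twist_scale p (twist_scale q f) = twist_scale (p * q) f.
Proof.
apply/funext => i; rewrite /twist_scale /= rmorphD !rmorphM /= scalerDl !scalerDr !scalerA.
rewrite -[_ * X * cst q.1]mulrA -[_ * X * cst q.2]mulrA !dual_xC !mulrA.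
by rewrite -[_ * X * X]mulrA dual_xx mulr0 scale0r addr0 addrA.
Qed.
Fact twist_scale1 : left_id 1 twist_scale.
Proof.
by move=> f; apply/funext => i; rewrite /twist_scale /= rmorph0 rmorph1 scale1r scale0r addr0.
Qed.
Fact twist_scaleDr : right_distributive twist_scale +%R.
Proof.
move=> p f g; apply/funext => i.
by rewrite /twist_scale -![(f + g) _]/(f _ + g _) !scalerDr addrACA.
Qed.
Fact twist_scaleDl f : {morph twist_scale^~ f : p q / p + q}.
Proof.
move=> p q; apply/funext => i.
rewrite -[RHS]/(twist_scale p f i + twist_scale q f i) /twist_scale /=.
by rewrite !rmorphD /= !scalerDl addrACA.
Qed.
HB.instance Definition _ := GRing.Zmodule_isLmodule.Build A twist
  twist_scaleA twist_scale1 twist_scaleDr twist_scaleDl.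

Lemma twist_sumE (s : seq int) (f : int -> twist) j :
  (\sum_(i <- s) f i) j = \sum_(i <- s) f i j.
Proof. by apply: (big_morph (fun g : twist => g j)). Qed.

Lemma finsupp_twist (p : A) (f g : twist) :
  finsupp f -> finsupp g -> finsupp (p *: f + g).
Proof.
move=> fs gs; have fs' := finsupp_shift fs.
have := finsuppL (cst p.1) fs (finsuppL (cst p.2 * X) fs' gs).
congr finsupp; apply/funext => i.
by rewrite -[RHS]/(_ *: _ + _ *: _ + g i) -addrA -scalerA.
Qed.

(** Setting t = 1 is A-linear. *)
Lemma fsum_twist (p : A) (f g : twist) :
  finsupp f -> finsupp g -> fsum (p *: f + g) = p *: fsum f + fsum g.
Proof.
move=> fs gs; have fs' := finsupp_shift fs.
have -> : p *: f + g = (fun i => cst p.1 *: f i + ((cst p.2 * X) *: f (i - 1) + g i)).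
  by apply/funext => i; rewrite -[LHS]/(_ *: _ + _ *: _ + g i) -addrA -scalerA.
rewrite (fsumL _ fs (finsuppL (cst p.2 * X) fs' gs)) (fsumL _ fs' gs) fsum_shift.
by rewrite [p *: fsum f]dual_scale addrA scalerA.
Qed.

End Twist.

(** * Homogeneous components *)

Section Components.
Variables (R : pzRingType).
Implicit Types M N : gmod R.
Local Notation cst := (@dual_const R).
Local Notation X := (dual_x R).

Lemma decomposition M (m : M) : exists c : int -> M,
  [/\ forall i, gmod_deg M i (c i), finsupp c & fsum c = m].
Proof.
have [s [f [us fdeg ->]]] := gmod_span m.
exists (fun i => if i \in s then f i else 0); split=> [i||].
- by case: ifP => _ //; apply: gmod_deg0.
- by exists s => i /negPf ->.
- rewrite (@fsum_seq _ _ _ s) // => [|i /negPf -> //].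
  by apply: eq_big_seq => i ->.
Qed.

Definition gcomp M (m : M) : int -> M := projT1 (cid (decomposition m)).

Lemma gcomp_deg M (m : M) i : gmod_deg M i (gcomp m i).
Proof. by rewrite /gcomp; case: cid => c []. Qed.
Lemma gcomp_finsupp M (m : M) : finsupp (gcomp m).
Proof. by rewrite /gcomp; case: cid => c []. Qed.
Lemma gcomp_sum M (m : M) : fsum (gcomp m) = m.
Proof. by rewrite /gcomp; case: cid => c []. Qed.

(** The difference of two decompositions is a decomposition of zero. *)
Lemma gcomp_uniq M (c : int -> M) :
  (forall i, gmod_deg M i (c i)) -> finsupp c -> gcomp (fsum c) = c.
Proof.
move=> cdeg cs; apply/funext => i; apply/eqP; rewrite -subr_eq0.
set g := gcomp _; have gs : finsupp g := gcomp_finsupp _.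
pose d i := -1 *: c i + g i.
have ds : finsupp d := finsuppL (-1) cs gs.
have d0 : fsum d = 0 by rewrite (fsumL _ cs gs) gcomp_sum scaleN1r addNr.
have ddeg j : gmod_deg M j (d j).
  by rewrite /d scaleN1r addrC; apply: gmod_degB => //; apply: gcomp_deg.
have [s [us sd]] := finsupp_uniq ds.
move: d0; rewrite (fsum_seq us sd) => /(gmod_free us ddeg) dz.
suff: d i = 0 by rewrite /d scaleN1r addrC => ->.
by have [/dz|/sd] := boolP (i \in s).
Qed.

Lemma gcomp_id M (m : M) i : gmod_deg M i m ->
  gcomp m i = m /\ forall j, j != i -> gcomp m j = 0.
Proof.
move=> mi; pose c j := if j == i then m else 0.
have c0 j : j != i -> c j = 0 by rewrite /c => /negPf ->.
have ci : c i = m by rewrite /c eqxx.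
have -> : gcomp m = c; last by rewrite ci.
rewrite -{1}ci -(fsum1 c0); apply: gcomp_uniq (finsupp1 c0) => j.
by rewrite /c; case: eqP => [->|_] //; apply: gmod_deg0.
Qed.

Lemma gcomp0 M i : gcomp (0 : M) i = 0.
Proof. by have [] := gcomp_id (gmod_deg0 M i). Qed.

Lemma gcomp_ghom M N (f : ghom M N) m i : gcomp (f m) i = f (gcomp m i).
Proof.
have ms := gcomp_finsupp m.
rewrite -{1}(gcomp_sum m) (fsum_map (ghom_fun f) ms) gcomp_uniq // => [j|].
  exact/ghom_deg/gcomp_deg.
by have [s sm] := ms; exists s => j /sm ->; rewrite raddf0.
Qed.

Lemma gmod_degL M i (a : R) (m n : M) :
  gmod_deg M i m -> gmod_deg M i n -> gmod_deg M i (cst a *: m + n).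
Proof.
move=> mi ni; rewrite -[n]opprK; apply: gmod_degB.
  by rewrite -[i]add0r; apply: gmod_degZ.
by rewrite -[- n]add0r; apply/gmod_degB/ni/gmod_deg0.
Qed.

Lemma gmod_degX M i (m : M) : gmod_deg M (i - 1) m -> gmod_deg M i (X *: m).
Proof. by move=> mi; rewrite -[i](subrK 1) addrC; apply: gmod_degZ. Qed.

Lemma gmod_deg_twist M (p : dual_num R) (f g : twist M) :
  (forall i, gmod_deg M i (f i)) -> (forall i, gmod_deg M i (g i)) ->
  forall i, gmod_deg M i ((p *: f + g) i).
Proof.
move=> fdeg gdeg i; rewrite -[Y in gmod_deg M i Y]/(_ *: _ + _ *: _ + g i) -addrA.
by apply: gmod_degL => //; apply: gmod_degL => //; apply: gmod_degX.
Qed.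

(** Sending m to the sum of the m_i t^i is A-linear. *)
Lemma gcomp_twist M (p : dual_num R) (m n : M) :
  gcomp (p *: m + n) = (p *: (gcomp m : twist M) + gcomp n : twist M).
Proof.
rewrite -{1}(gcomp_sum m) -{1}(gcomp_sum n).
rewrite -(@fsum_twist R M p _ _ (gcomp_finsupp m) (gcomp_finsupp n)).
apply: gcomp_uniq; last by apply: finsupp_twist; apply: gcomp_finsupp.
by apply: gmod_deg_twist; apply: gcomp_deg.
Qed.

End Components.

(** * Graded submodules and quotients *)

Section GradedSubquotients.
Variable R : pzRingType.
Implicit Types M N K : gmod R.

Definition homogeneous M (N : submodule M) : Prop :=
  forall m, N m -> forall i, N (gcomp m i).

Lemma ghom_ker_homogeneous M N (f : ghom M N) :
  homogeneous (lker_submodule (ghom_fun f)).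
Proof. by move=> m /= fm0 i; rewrite -gcomp_ghom fm0 gcomp0. Qed.

Lemma ghom_img_homogeneous M N (f : ghom M N) :
  homogeneous (limg_submodule (ghom_fun f)).
Proof. by move=> _ [m <-] i; exists (gcomp m i); rewrite gcomp_ghom. Qed.

Arguments ghom_ker_homogeneous {M N} f.
Arguments ghom_img_homogeneous {M N} f.

Lemma graded_submodule M (N : submodule M) : homogeneous N ->
  exists (K : gmod R) (i : ghom K M),
    injective i /\ forall m, N m <-> exists k, i k = m.
Proof.
move=> Nhom; pose T : lmodType (dual_num R) := submod N.
pose deg (i : int) (x : T) := gmod_deg M i (val x).
have deg0 i : deg i 0 by apply: gmod_deg0.
have degB i x y : deg i x -> deg i y -> deg i (x - y) by apply: gmod_degB.
have span (x : T) : exists (s : seq int) (f : int -> T),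
    [/\ uniq s, forall i, deg i (f i) & x = \sum_(i <- s) f i].
  have [s [us sx]] := finsupp_uniq (gcomp_finsupp (val x)).
  exists s, (fun i => in_submod (Nhom _ (submodP x) i)).
  split=> // [i|]; first exact: gcomp_deg.
  apply: val_inj; rewrite raddf_sum /= -[LHS]gcomp_sum (fsum_seq us sx).
  by apply: eq_bigr.
have free (s : seq int) (f : int -> T) : uniq s -> (forall i, deg i (f i)) ->
    \sum_(i <- s) f i = 0 -> forall i, i \in s -> f i = 0.
  move=> us fdeg /(congr1 val); rewrite raddf_sum => f0 i is_; apply: val_inj.
  exact: (gmod_free us fdeg f0).
have degZ (i j : int) (p : dual_num R) (x : T) :
    dual_deg i p -> deg j x -> deg (i + j) (p *: x) by apply: gmod_degZ.
pose K := GradedModule deg0 degB span free degZ.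
exists K, (@GradedHom R K M (val : {linear T -> M}) (fun _ _ => id)).
split; first exact: val_inj.
move=> m; split=> [Nm|[k <-]]; last exact: (submodP k).
by exists (in_submod Nm).
Qed.

Lemma graded_quotient M (N : submodule M) : homogeneous N ->
  exists (Q : gmod R) (p : ghom M Q), onto p /\ forall m, p m = 0 <-> N m.
Proof.
move=> Nhom; have [T [p [pO pN]]] := quotient_exists N.
pose deg (i : int) (x : T) := exists2 m, gmod_deg M i m & p m = x.
have deg0 i : deg i 0 by exists 0; [apply: gmod_deg0 | rewrite raddf0].
have degB i x y : deg i x -> deg i y -> deg i (x - y).
  move=> [m mi <-] [n ni <-]; exists (m - n); last by rewrite raddfB.
  exact: gmod_degB.
have span (x : T) : exists (s : seq int) (f : int -> T),
    [/\ uniq s, forall i, deg i (f i) & x = \sum_(i <- s) f i].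
  have [m <-] := pO x; have [s [us sm]] := finsupp_uniq (gcomp_finsupp m).
  exists s, (fun i => p (gcomp m i)); split=> // [i|].
    by exists (gcomp m i) => //; apply: gcomp_deg.
  by rewrite -[in LHS](gcomp_sum m) (fsum_seq us sm) raddf_sum.
have free (s : seq int) (f : int -> T) : uniq s -> (forall i, deg i (f i)) ->
    \sum_(i <- s) f i = 0 -> forall i, i \in s -> f i = 0.
  move=> us fdeg f0 i is_.
  have [g gP] := choice (fun i => let: ex_intro2 m mi pm := fdeg i in
     ex_intro (fun m => gmod_deg M i m /\ p m = f i) m (conj mi pm)).
  pose c j := if j \in s then g j else 0.
  have c0 j : j \notin s -> c j = 0 by rewrite /c => /negPf ->.
  have cdeg j : gmod_deg M j (c j).
    by rewrite /c; case: ifP => _; [have [] := gP j | apply: gmod_deg0].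
  have cN : N (fsum c).
    apply/pN; rewrite (fsum_seq us c0) raddf_sum -[RHS]f0.
    by apply: eq_big_seq => j js; rewrite /c js; have [] := gP j.
  have /pN := Nhom _ cN i.
  rewrite gcomp_uniq //; last by exists s.
  by rewrite /c is_; have [_ ->] := gP i.
have degZ (i j : int) (a : dual_num R) (x : T) :
    dual_deg i a -> deg j x -> deg (i + j) (a *: x).
  move=> ai [m mj <-]; exists (a *: m); last by rewrite linearZ.
  exact: gmod_degZ.
pose Q := GradedModule deg0 degB span free degZ.
exists Q, (@GradedHom R M Q p (fun i m mi => ex_intro2 _ _ m mi erefl)).
by split.
Qed.

(** As for modules, with the graded cokernel. *)
Lemma GrMod_epi_onto M N (e : ghom M N) : @is_epi (GrMod R) M N e -> onto e.
Proof.
move=> eE; have [Q [p [_ pE]]] := graded_quotient (ghom_img_homogeneous e).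
have p0 : p = ghom_zero N Q.
  by apply: eE; apply: ghom_ext => u /=; apply/pE; exists u.
by move=> v; apply/(pE v); rewrite p0.
Qed.

(** Compare with the explicit graded kernels of i and of g. *)
Lemma GrMod_kernel_elements M N K (g : ghom M N) (i : ghom K M) :
  @is_kernel (GrMod R) M N K g i ->
  injective i /\ forall m, g m = 0 <-> exists k, i k = m.
Proof.
move=> iK; have [gi0 univ] := iK.
split=> [|m].
  have [K' [j [_ jE]]] := graded_submodule (ghom_ker_homogeneous i).
  have j0 : j = ghom_zero K' K.
    apply: (kernel_mono iK); apply: ghom_ext => k /=.
    by rewrite raddf0; apply/jE; exists k.
  apply: raddf_inj => k /jE[k' <-].
  by rewrite j0.
split=> [gm0|[k <-]]; last exact: (congr1 (fun h : ghom K N => h k) gi0).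
have [K' [j [_ jE]]] := graded_submodule (ghom_ker_homogeneous g).
have [|f [fE _]] := univ K' j.
  by apply: ghom_ext => k /=; apply/jE; exists k.
have /jE[k km] := gm0; exists (f k); rewrite -km.
exact: (congr1 (fun h : ghom K' M => h k) fE).
Qed.

(** The linear maps given by the universal properties respect degrees: i is
    injective, p is onto, and both commute with the homogeneous components. *)
Lemma lexact_short_exact M N K (i : ghom K M) (p : ghom M N) :
  lexact (ghom_fun i) (ghom_fun p) -> @short_exact (GrMod R) K M N i p.
Proof.
move=> ip; have [iinj pO ex] := ip; split.
- split=> [|L h ph0].
    by apply: ghom_ext => k /=; apply: (lexact_comp0 _ ip).
  have ph x : p (h x) = 0 by exact: (congr1 (fun f : ghom L N => f x) ph0).
  have [u uE] := lexact_lift ip ph.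
  have udeg j x : gmod_deg L j x -> gmod_deg K j (u x).
    move=> xj; suff -> : u x = gcomp (u x) j by apply: gcomp_deg.
    apply: iinj; rewrite -gcomp_ghom uE.
    by have [-> _] := gcomp_id (ghom_deg h xj).
  exists (GradedHom udeg); split=> [|v vE]; apply: ghom_ext => x //=.
  apply: iinj; rewrite uE -[LHS]/(h x).
  by rewrite -vE.
- move=> L f g fg; apply: ghom_ext => y; have [x <-] := pO y.
  exact: (congr1 (fun h : ghom M L => h x) fg).
- move=> L h hi0.
  have hi x : h (i x) = 0 by exact: (congr1 (fun f : ghom K L => f x) hi0).
  have [u uE] := lexact_factor ip hi.
  have udeg j y : gmod_deg N j y -> gmod_deg L j (u y).
    move=> yj; have [x xy] := pO y.
    have [<- _] := gcomp_id yj; rewrite -xy gcomp_ghom uE.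
    exact/ghom_deg/gcomp_deg.
  by exists (GradedHom udeg); apply: ghom_ext.
Qed.

Lemma GrMod_quotients K M (i : ghom K M) : injective i ->
  exists (N : gmod R) (p : ghom M N), lexact (ghom_fun i) (ghom_fun p).
Proof.
move=> iinj; have [N [p [pO pE]]] := graded_quotient (ghom_img_homogeneous i).
by exists N, p.
Qed.

Lemma GrMod_kernels M N (p : ghom M N) : onto p ->
  exists (K : gmod R) (i : ghom K M), lexact (ghom_fun i) (ghom_fun p).
Proof.
move=> pO; have [K [i [iinj iE]]] := graded_submodule (ghom_ker_homogeneous p).
by exists K, i.
Qed.

End GradedSubquotients.

(** * Forgetting the grading and its adjoints *)

Section Forgetful.
Variable R : pzRingType.
Local Notation A := (dual_num R).
Local Notation cst := (@dual_const R).
Local Notation X := (dual_x R).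
Implicit Types (M N : gmod R) (Q : lmodType A).

Definition Forget : functor (GrMod R) (Mod A).
Proof.
exact: (@Functor (GrMod R) (Mod A) (fun M => M : lmodType A)
  (fun M N f => ghom_fun f) (fun _ => erefl) (fun _ _ _ _ _ => erefl) (fun _ _ => erefl)).
Defined.

Section Laurent.
Variable Q : lmodType A.

(** Q[t, 1/t], graded by the powers of t. *)
Definition laurent_submodule : submodule (twist Q) :=
  @Submodule A (twist Q) (@finsupp _ Q) (ex_intro _ [::] (fun _ _ => erefl))
    (@finsupp_twist R Q).
Definition laurent_sort : lmodType A := submod laurent_submodule.
Definition laurent_coef (f : laurent_sort) : int -> Q := val f.

Lemma laurent_finsupp f : finsupp (laurent_coef f).
Proof. exact: (@submodP _ _ laurent_submodule f). Qed.

Lemma laurent_ext f g : laurent_coef f =1 laurent_coef g -> f = g.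
Proof. by move=> fg; apply/val_inj/funext. Qed.

Lemma laurent_coefL p f g i : laurent_coef (p *: f + g) i =
  cst p.1 *: laurent_coef f i + cst p.2 *: (X *: laurent_coef f (i - 1))
  + laurent_coef g i.
Proof. by []. Qed.

Lemma laurent_coef_sum (s : seq int) (F : int -> laurent_sort) j :
  laurent_coef (\sum_(i <- s) F i) j = \sum_(i <- s) laurent_coef (F i) j.
Proof. by rewrite /laurent_coef raddf_sum twist_sumE. Qed.

Lemma monomial_finsupp (i : int) (q : Q) : finsupp (fun j => if j == i then q else 0).
Proof. by apply: (@finsupp1 _ _ _ i) => j /negPf ->. Qed.
Definition monomial (i : int) (q : Q) : laurent_sort :=
  @in_submod _ _ laurent_submodule _ (monomial_finsupp i q).

Lemma monomialE i q j : laurent_coef (monomial i q) j = if j == i then q else 0.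
Proof. by []. Qed.

Definition laurent_deg (i : int) (f : laurent_sort) : Prop :=
  forall j, j != i -> laurent_coef f j = 0.

Lemma monomial_deg i q : laurent_deg i (monomial i q).
Proof. by move=> j /negPf ji; rewrite monomialE ji. Qed.

Lemma laurent_sum (f : laurent_sort) : f = fsum (fun i => monomial i (laurent_coef f i)).
Proof.
have [s [us sf]] := finsupp_uniq (laurent_finsupp f).
rewrite (fsum_seq us) => [|i /sf ->]; last first.
  by apply: laurent_ext => j; rewrite monomialE; case: eqP.
apply: laurent_ext => j; rewrite laurent_coef_sum.
have [js|jNs] := boolP (j \in s).
  rewrite (bigD1_seq j) //= monomialE eqxx big1 ?addr0 // => i.
  by rewrite monomialE eq_sym => /negPf ->.
rewrite (sf _ jNs) big1_seq // => i /andP[_ is_]; rewrite monomialE.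
by case: eqP is_ jNs => // -> ->.
Qed.

Fact laurent_deg0 i : laurent_deg i 0. Proof. by []. Qed.
Fact laurent_degB i f g : laurent_deg i f -> laurent_deg i g -> laurent_deg i (f - g).
Proof.
move=> fi gi j ji; rewrite -[LHS]/(laurent_coef f j - laurent_coef g j).
by rewrite fi // gi // subr0.
Qed.
Fact laurent_span (f : laurent_sort) : exists (s : seq int) (c : int -> laurent_sort),
  [/\ uniq s, forall i, laurent_deg i (c i) & f = \sum_(i <- s) c i].
Proof.
have [s [us sf]] := finsupp_uniq (laurent_finsupp f).
exists s, (fun i => monomial i (laurent_coef f i)); split=> // [i|].
  exact: monomial_deg.
rewrite -fsum_seq //; first exact: laurent_sum.
by move=> i /sf ->; apply: laurent_ext => j; rewrite monomialE; case: eqP.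
Qed.
Fact laurent_free (s : seq int) (c : int -> laurent_sort) :
  uniq s -> (forall i, laurent_deg i (c i)) -> \sum_(i <- s) c i = 0 ->
  forall i, i \in s -> c i = 0.
Proof.
move=> us cdeg c0 i is_; apply: laurent_ext => j.
have [->|/cdeg -> //] := eqVneq j i.
have := congr1 (fun f => laurent_coef f i) c0.
rewrite /= laurent_coef_sum (bigD1_seq i) //= big1 ?addr0 // => k ki.
by rewrite cdeg // eq_sym.
Qed.
Fact laurent_degZ (i j : int) (p : A) (f : laurent_sort) :
  dual_deg i p -> laurent_deg j f -> laurent_deg (i + j) (p *: f).
Proof.
move=> pi fj k kij.
rewrite -[LHS]/(cst p.1 *: laurent_coef f k
                + cst p.2 *: (X *: laurent_coef f (k - 1))).
move: pi; rewrite /dual_deg; case: eqP => [i0|_].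
  move=> ->; rewrite rmorph0 scale0r addr0 fj ?scaler0 //.
  by rewrite i0 add0r in kij.
case: eqP => [i1|_] => ->; last by rewrite !rmorph0 !scale0r addr0.
rewrite rmorph0 scale0r add0r fj ?scaler0 //.
by rewrite subr_eq addrC -i1.
Qed.

Definition laurent : gmod R :=
  GradedModule laurent_deg0 laurent_degB laurent_span laurent_free laurent_degZ.

Lemma laurent_total_linear p (f g : laurent_sort) :
  fsum (laurent_coef (p *: f + g)) =
  p *: fsum (laurent_coef f) + fsum (laurent_coef g).
Proof. exact: (@fsum_twist R Q p _ _ (laurent_finsupp f) (laurent_finsupp g)). Qed.

Lemma laurent_gcomp (f : laurent) i : gcomp f i = monomial i (laurent_coef f i).
Proof.
rewrite {1}(laurent_sum f) (@gcomp_uniq R laurent) // => [j|]; first exact: monomial_deg.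
have [s sf] := laurent_finsupp f; exists s => j /sf ->.
by apply: laurent_ext => k; rewrite monomialE; case: eqP.
Qed.

End Laurent.
End Forgetful.
Arguments monomial_deg {R Q} i q.

Section ForgetLaurent.
Variable R : pzRingType.
Local Notation A := (dual_num R).
Local Notation cst := (@dual_const R).
Local Notation X := (dual_x R).
Implicit Types (M N : gmod R) (Q : lmodType A).

Section LaurentMap.
Variables (Q Q' : lmodType A) (g : {linear Q -> Q'}).
Fact laurent_map_finsupp (f : laurent_sort Q) : finsupp (fun i => g (laurent_coef f i)).
Proof. by have [s sf] := laurent_finsupp f; exists s => i /sf ->; rewrite raddf0. Qed.
Definition laurent_map_fun (f : laurent_sort Q) : laurent_sort Q' :=
  @in_submod _ _ (laurent_submodule Q') _ (laurent_map_finsupp f).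
Fact laurent_map_linear p f h :
  laurent_map_fun (p *: f + h) = p *: laurent_map_fun f + laurent_map_fun h.
Proof.
apply: laurent_ext => i; rewrite laurent_coefL.
rewrite -![laurent_coef (laurent_map_fun _) _]/(g (laurent_coef _ _)) laurent_coefL.
by rewrite !linearD !linearZ.
Qed.
Fact laurent_map_deg i f : laurent_deg i f -> laurent_deg i (laurent_map_fun f).
Proof.
move=> fi j /fi fj.
by rewrite -[LHS]/(g (laurent_coef f j)) fj raddf0.
Qed.
Definition laurent_map : ghom (laurent Q) (laurent Q') :=
  @GradedHom R (laurent Q) (laurent Q') (to_linear laurent_map_linear) laurent_map_deg.
End LaurentMap.

Definition Laurent : functor (Mod A) (GrMod R).
Proof.
refine (@Functor (Mod A) (GrMod R) (fun Q => laurent Q) laurent_map _ _ _);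
  by move=> *; apply: ghom_ext => f; apply: laurent_ext.
Defined.

Section ForgetAdj.
Variables (N : gmod R) (Q : lmodType A).

Section Adj.
Variable g : {linear N -> Q}.
Fact forget_adj_finsupp (n : N) : finsupp (fun i => g (gcomp n i)).
Proof. by have [s sn] := gcomp_finsupp n; exists s => i /sn ->; rewrite raddf0. Qed.
Definition forget_adj_fun (n : N) : laurent_sort Q :=
  @in_submod _ _ (laurent_submodule Q) _ (forget_adj_finsupp n).
Fact forget_adj_linear p m n :
  forget_adj_fun (p *: m + n) = p *: forget_adj_fun m + forget_adj_fun n.
Proof.
apply: laurent_ext => i; rewrite laurent_coefL.
rewrite -![laurent_coef (forget_adj_fun _) _]/(g (gcomp _ _)) gcomp_twist.
rewrite -[(_ + gcomp n) i]/(_ *: _ + _ *: (X *: gcomp m (i - 1)) + gcomp n i).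
by rewrite !linearD !linearZ.
Qed.
Fact forget_adj_deg i n : gmod_deg N i n -> laurent_deg i (forget_adj_fun n).
Proof.
move=> /gcomp_id[_ n0] j /n0 nj.
by rewrite -[LHS]/(g (gcomp n j)) nj raddf0.
Qed.
Definition forget_adj : ghom N (laurent Q) :=
  @GradedHom R N (laurent Q) (to_linear forget_adj_linear) forget_adj_deg.
End Adj.

Fact forget_adjV_linear (h : ghom N (laurent Q)) p m n :
  fsum (laurent_coef (h (p *: m + n))) =
  p *: fsum (laurent_coef (h m)) + fsum (laurent_coef (h n)).
Proof. by rewrite linearP laurent_total_linear. Qed.
Definition forget_adjV (h : ghom N (laurent Q)) : {linear N -> Q} :=
  to_linear (forget_adjV_linear h).
End ForgetAdj.

(** A linear map g corresponds to n |-> sum of the g(n_i) t^i, with inverse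
    given by setting t = 1. *)
Definition forget_laurent : adjunction (Forget R) Laurent.
Proof.
refine (@Adjunction _ _ (Forget R) Laurent forget_adj forget_adjV _ _ _ _).
- move=> N Q g; apply: linear_ext => n /=.
  rewrite -[in RHS](gcomp_sum n) (fsum_map g (gcomp_finsupp n)).
  by [].
- move=> N Q h; apply: ghom_ext => n; apply: laurent_ext => i.
  rewrite -[LHS]/(fsum (laurent_coef (h (gcomp n i)))) -gcomp_ghom laurent_gcomp.
  by rewrite (@fsum1 _ _ _ i) ?monomialE ?eqxx // => j; apply: monomial_deg.
- move=> N N' Q f g; apply: ghom_ext => n; apply: laurent_ext => i.
  by rewrite -[RHS]/(f (gcomp (g n) i)) gcomp_ghom.
- by move=> N Q Q' h f; apply: ghom_ext => n; apply: laurent_ext.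
Defined.

Section Product.
Variable N : gmod R.
(** The product of the N^i, as the formal sums of the f i t^i with f i in N^i. *)
Fact product_mem0 i : gmod_deg N i ((0 : twist N) i).
Proof. exact: gmod_deg0. Qed.
Definition product_submodule : submodule (twist N) :=
  @Submodule A (twist N) (fun f => forall i, gmod_deg N i (f i))
    product_mem0 (@gmod_deg_twist R N).
Definition product : lmodType A := submod product_submodule.
Definition product_coef (f : product) : int -> N := val f.

Lemma product_deg f i : gmod_deg N i (product_coef f i).
Proof. exact: (@submodP _ _ product_submodule f). Qed.
Lemma product_ext f g : product_coef f =1 product_coef g -> f = g.
Proof. by move=> fg; apply/val_inj/funext. Qed.
Lemma product_coefL p f g i : product_coef (p *: f + g) i =
  cst p.1 *: product_coef f i + cst p.2 *: (X *: product_coef f (i - 1))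
  + product_coef g i.
Proof. by []. Qed.
Definition in_product (f : int -> N) (fdeg : forall i, gmod_deg N i (f i)) : product :=
  @in_submod _ _ product_submodule f fdeg.
End Product.

Section ProductMap.
Variables (N N' : gmod R) (g : ghom N N').
Definition product_map_fun (f : product N) : product N' :=
  in_product (fun i => ghom_deg g (product_deg f i)).
Fact product_map_linear p f h :
  product_map_fun (p *: f + h) = p *: product_map_fun f + product_map_fun h.
Proof.
apply: product_ext => i; rewrite product_coefL.
rewrite -![product_coef (product_map_fun _) _]/(g (product_coef _ _)) product_coefL.
by rewrite !linearD !linearZ.
Qed.
Definition product_map : {linear product N -> product N'} := to_linear product_map_linear.
End ProductMap.

Definition Product : functor (GrMod R) (Mod A).
Proof.
refine (@Functor (GrMod R) (Mod A) (fun N => product N) product_map _ _ _);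
  by move=> *; apply: linear_ext => f; apply: product_ext.
Defined.

Section LaurentAdj.
Variables (Q : lmodType A) (N : gmod R).

Section Adj.
Variable h : ghom (laurent Q) N.
Definition laurent_adj_fun (q : Q) : product N :=
  in_product (fun i => ghom_deg h (monomial_deg i q)).
Fact laurent_adj_linear p q q' :
  laurent_adj_fun (p *: q + q') = p *: laurent_adj_fun q + laurent_adj_fun q'.
Proof.
apply: product_ext => i; rewrite product_coefL.
rewrite -![product_coef (laurent_adj_fun _) _]/(h (monomial _ _)).
rewrite -!linearZ -!linearD; congr (h _); apply: laurent_ext => j.
rewrite -[RHS]/(laurent_coef (cst p.1 *: monomial i q) j
  + laurent_coef (cst p.2 *: (X *: monomial (i - 1) q)) j + laurent_coef (monomial i q') j).
have cE a (f : laurent_sort Q) k : laurent_coef (cst a *: f) k = cst a *: laurent_coef f k.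
  rewrite -[LHS]/(cst a *: laurent_coef f k + cst 0 *: (X *: laurent_coef f (k - 1))).
  by rewrite rmorph0 scale0r addr0.
have xE (f : laurent_sort Q) k : laurent_coef (X *: f) k = X *: laurent_coef f (k - 1).
  rewrite -[LHS]/(cst 0 *: laurent_coef f k + cst 1 *: (X *: laurent_coef f (k - 1))).
  by rewrite rmorph0 scale0r add0r rmorph1 scale1r.
rewrite !cE xE !monomialE (inj_eq (addIr (- 1))).
by case: eqP => _; rewrite ?scaler0 ?addr0 // -dual_scale.
Qed.
Definition laurent_adj : {linear Q -> product N} := to_linear laurent_adj_linear.
End Adj.

Section AdjV.
Variable k : {linear Q -> product N}.
Definition laurent_adjV_coef (f : laurent_sort Q) : twist N :=
  fun i => product_coef (k (laurent_coef f i)) i.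
Lemma laurent_adjV_finsupp f : finsupp (laurent_adjV_coef f).
Proof.
have [s sf] := laurent_finsupp f; exists s => i /sf.
by rewrite /laurent_adjV_coef => ->; rewrite raddf0.
Qed.
Fact laurent_adjV_linear p f g :
  fsum (laurent_adjV_coef (p *: f + g)) =
  p *: fsum (laurent_adjV_coef f) + fsum (laurent_adjV_coef g).
Proof.
rewrite -(@fsum_twist R N p _ _ (laurent_adjV_finsupp f) (laurent_adjV_finsupp g)).
congr fsum; apply/funext => i.
rewrite -[RHS]/(cst p.1 *: laurent_adjV_coef f i
  + cst p.2 *: (X *: laurent_adjV_coef f (i - 1)) + laurent_adjV_coef g i).
rewrite /laurent_adjV_coef laurent_coefL.
have kE a q q' j : product_coef (k (cst a *: q + q')) j =
    cst a *: product_coef (k q) j + product_coef (k q') j.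
  by rewrite linearP product_coefL rmorph0 scale0r addr0.
have kX q j : product_coef (k (X *: q)) j = X *: product_coef (k q) (j - 1).
  rewrite linearZ -[LHS]/(cst 0 *: product_coef (k q) j
    + cst 1 *: (X *: product_coef (k q) (j - 1))).
  by rewrite rmorph0 scale0r add0r rmorph1 scale1r.
by rewrite -addrA !kE kX addrA.
Qed.
Fact laurent_adjV_deg i f :
  laurent_deg i f -> gmod_deg N i (fsum (laurent_adjV_coef f)).
Proof.
move=> fi; rewrite (@fsum1 _ _ _ i); first exact: product_deg.
by move=> j /fi; rewrite /laurent_adjV_coef => ->; rewrite raddf0.
Qed.
Definition laurent_adjV : ghom (laurent Q) N :=
  @GradedHom R (laurent Q) N (to_linear laurent_adjV_linear) laurent_adjV_deg.
End AdjV.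
End LaurentAdj.

(** A graded map h corresponds to q |-> (h(q t^i))_i. *)
Definition laurent_product : adjunction Laurent Product.
Proof.
refine (@Adjunction _ _ Laurent Product laurent_adj laurent_adjV _ _ _ _).
- move=> Q N h; apply: ghom_ext => f.
  rewrite -[LHS]/(fsum (fun i => h (monomial i (laurent_coef f i)))).
  rewrite [in RHS](laurent_sum f) (fsum_map (ghom_fun h)) //.
  have [s sf] := laurent_finsupp f; exists s => i /sf ->.
  by apply: laurent_ext => j; rewrite monomialE; case: eqP.
- move=> Q N k; apply: linear_ext => q; apply: product_ext => i.
  rewrite -[LHS]/(fsum (laurent_adjV_coef k (monomial i q))) (@fsum1 _ _ _ i).
    by rewrite /laurent_adjV_coef monomialE eqxx.
  by move=> j /negPf ji; rewrite /laurent_adjV_coef monomialE ji raddf0.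
- move=> Q Q' N f g; apply: linear_ext => q; apply: product_ext => i.
  rewrite -[LHS]/(f (laurent_map g (monomial i q))) -[RHS]/(f (monomial i (g q))).
  congr (f _); apply: laurent_ext => j.
  rewrite -[LHS]/(g (laurent_coef (monomial i q) j)) !monomialE.
  by case: eqP => //; rewrite raddf0.
- by move=> Q N N' h f; apply: linear_ext => q; apply: product_ext.
Defined.

Lemma product_epi : preserves_epi Product.
Proof.
move=> N N' e /GrMod_epi_onto eO; apply/Mod_epiP => f.
have [g gE] := choice (fun i => eO (product_coef f i)).
exists (in_product (fun i => gcomp_deg (g i) i)); apply: product_ext => i.
rewrite -[LHS]/(e (gcomp (g i) i)) -gcomp_ghom gE.
by have [-> _] := gcomp_id (product_deg f i).
Qed.

(** A graded map is determined by its values on homogeneous elements, which are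
    the entries of elements of the product. *)
Lemma product_faithful N N' (u v : @cat_hom (GrMod R) N N') :
  fmap Product u = fmap Product v -> u = v.
Proof.
move=> uv; apply: ghom_ext => n.
rewrite -(gcomp_sum n) !(fsum_map _ (gcomp_finsupp n)); congr fsum; apply/funext => i.
pose f := in_product (gcomp_deg n).
exact: (congr1 (fun h : {linear product N -> product N'} => product_coef (h f) i) uv).
Qed.

Lemma forget_kernel : preserves_kernel (Forget R).
Proof. by move=> M N K g i iK; apply/Mod_kernelP/GrMod_kernel_elements. Qed.

End ForgetLaurent.

Theorem theoremB (R : pzRingType) (M : gmod R) :
  [<-> Gorenstein_projective (M : GrMod R);
       Gorenstein_projective ((M : lmodType (dual_num R)) : Mod (dual_num R));
       Gorenstein_projective
         ((restriction (@dual_const R) M : lmodType R) : Mod R)].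
Proof.
pose FL := forget_laurent R; pose LP := laurent_product R.
pose RE := restrict_extend R; pose ER := extend_restrict R.
have Repi : preserves_epi (Restrict R) := left_adjoint_epi RE.
have Rker : preserves_kernel (Restrict R) := right_adjoint_kernel ER.
tfae.
- exact: (Gorenstein_projective_adjoint FL LP (@forget_kernel R) (@product_epi R)).
- exact: (Gorenstein_projective_adjoint RE ER Rker Repi).
- apply: (Gorenstein_projective_reflect (adjunction_comp FL RE) (adjunction_comp ER LP)).
  + by move=> N N' e /product_epi/Repi.
  + move=> N N' u v uv; apply: product_faithful; apply: linear_ext => f.
    exact: (congr1 (fun h : {linear restriction (@dual_const R) (product N) ->
                                  restriction (@dual_const R) (product N')} => h f) uv).
  + move=> K N i iinj; have [Q [p ip]] := GrMod_quotients (i := i) iinj.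
    by exists Q, p; split; [exact: lexact_short_exact | exact: ip].
  + move=> N Q p /GrMod_epi_onto/GrMod_kernels[K [i ip]].
    by exists K, i; split; [exact: lexact_short_exact | exact: ip].
Qed.
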